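(* Let $F$ be an algebraically closed field and $n\ge 1$. Let $B\in M_n(F)$ be a nilpotent matrix and let $\lambda$ be the partition of $n$ determined by the Jordan canonical form of $B$. Then the partition $\mathcal{D}(\lambda)=(\mu_1,\mu_2,\ldots,\mu_k)$, $\mu_1\ge\mu_2\ge\cdots\ge\mu_k\ge 1$, corresponding to the generic element $A\in\mathcal{N}_B$, has decreasing parts differing by at least $2$, that is, $\mu_i-\mu_{i+1}\ge 2$ for all $1\le i<k$. Moreover $\mathcal{D}(\mathcal{D}(\lambda))=\mathcal{D}(\lambda)$; that is, $\mathcal{D}$ is an idempotent map on the set of partitions of $n$.
   Context: $M_n(F)$ is the algebra of $n\times n$ matrices over $F$ and $\mathcal{N}\subset M_n(F)$ is the variety of nilpotent matrices. To a nilpotent matrix one associates the partition of $n$ given by the sizes of its Jordan blocks. For a partition $\mu$ of $n$, $\mathcal{O}_\mu\subset\mathcal{N}$ denotes the $\mathrm{GL}_n(F)$-conjugation orbit of nilpotent matrices with Jordan partition $\mu$. For $B\in\mathcal{N}$, the nilpotent commutator of $B$ is $\mathcal{N}_B=\{A\in\mathcal{N}: AB=BA\}$; it is known that $\mathcal{N}_B$ is an irreducible variety (Zariski topology). Hence, if $B$ has Jordan partition $\lambda$, there is a unique partition $\mu$ of $n$ such that $\mathcal{O}_\mu\cap\mathcal{N}_B$ is dense in $\mathcal{N}_B$; it depends only on $\lambda$, and one defines $\mathcal{D}(\lambda)=\mu$. This gives a map $\mathcal{D}$ from the set of partitions of $n$ to itself. *)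

(* Defs.v *)
From HB Require Import structures.
From mathcomp Require Import all_boot all_order all_algebra.
From mathcomp Require Import classical_sets mpoly.

Set Implicit Arguments.
Unset Strict Implicit.
Unset Printing Implicit Defensive.

Import GRing.Theory.

Local Open Scope ring_scope.
Local Open Scope classical_set_scope.

Definition is_intpart (n : nat) (s : seq nat) : bool :=
  [&& sorted geq s, 0%N \notin s & sumn s == n].

Record intpart (n : nat) := Intpart { parts :> seq nat; _ : is_intpart n parts }.

HB.instance Definition _ n := [isSub for @parts n].
HB.instance Definition _ n := [Choice of intpart n by <:].

Lemma sum_parts (n : nat) (lam : intpart n) :
  (\sum_(i < size lam) nth 0 lam i)%N = n.
Proof.
case: lam => s /= /and3P[_ _ /eqP <-].
by rewrite sumnE (big_nth 0%N) big_mkord.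
Qed.

Definition jordan_block (F : fieldType) (k : nat) : 'M[F]_k :=
  \matrix_(i, j) ((j == i.+1 :> nat)%:R).

Definition jordan_mx (F : fieldType) (n : nat) (lam : intpart n) : 'M[F]_n :=
  castmx (sum_parts lam, sum_parts lam)
    (\mxdiag_(i < size lam) jordan_block F (nth 0%N lam i)).

(* The matrices whose Jordan partition is lam. *)
Definition jordan_orbit (F : fieldType) (n : nat) (lam : intpart n) : set 'M[F]_n :=
  [set A | exists2 P : 'M[F]_n,
     P \in unitmx & A = P *m jordan_mx F lam *m invmx P].

Definition nilpotent_mx (F : fieldType) (n : nat) (A : 'M[F]_n) : Prop :=
  exists k : nat, A ^+ k = 0.

Definition nilcomm (F : fieldType) (n : nat) (B : 'M[F]_n) : set 'M[F]_n :=
  [set A | nilpotent_mx A /\ comm_mx A B].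

Definition zero_locus (F : fieldType) (n : nat)
    (I : set {mpoly F[n * n]}) : set 'M[F]_n :=
  [set A | forall p, I p -> p.@[mxvec A 0] = 0].

Definition zariski_closed (F : fieldType) (n : nat) (Z : set 'M[F]_n) : Prop :=
  exists I, Z = zero_locus I.

Definition zariski_closure (F : fieldType) (n : nat) (S : set 'M[F]_n) :
    set 'M[F]_n :=
  \bigcap_(Z in [set Z | zariski_closed Z /\ S `<=` Z]) Z.

Definition zariski_dense_in (F : fieldType) (n : nat) (S T : set 'M[F]_n) :
    Prop :=
  S `<=` T /\ T `<=` zariski_closure S.

(* The value D(lam) is the partition of the generic element of the nilpotent
   commutator of any B with Jordan partition lam. The default value lam of xget
   would only be used if there were no such partition; it always exists because
   the nilpotent commutator is irreducible and meets finitely many orbits. *)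
Definition generic_intpart (F : closedFieldType) (n : nat) (lam : intpart n) :
    intpart n :=
  xget lam [set mu | forall B : 'M[F]_n, jordan_orbit lam B ->
              zariski_dense_in (jordan_orbit mu `&` nilcomm B) (nilcomm B)].

(* Main.v *)
Require Import Defs.
From mathcomp Require Import all_boot all_order all_algebra.
From mathcomp Require Import classical_sets.
From mathcomp Require Import perm finfield mxabelem mpoly.
From mathcomp Require Import zify ring.

(** Write M_lam for the module with blocks F[x]/x^(lam_i), on which x acts as the
    Jordan matrix J_lam; a matrix commuting with J_lam is an endomorphism of
    M_lam.

    Existence of the generic type. Every nilpotent endomorphism of M_lam is
    conjugate, under automorphisms, to an element of one linear space jnil lam of
    nilpotent endomorphisms: the induced action on the generators of M_lam is
    nilpotent and can be triangularized (jhom_to_jnil). On a linear space the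
    ranks of all powers are simultaneously maximal at a general point of every
    line through a best point, and these ranks determine the Jordan type. This
    gives one type mu that is dense (generic_exists), and mu dominates all the
    types that occur (generic_jnil).

    Types with gaps are fixed. If the parts of mu differ by at least 2, give the
    cell t of a block of length l the weight 2t - l + 1. All nilpotent
    endomorphisms of M_mu then raise weights by at least 2, and since the weights
    are symmetric about 0 this bounds the rank of a k-th power by the rank of
    (J_mu)^k (jnil_rank_le). As J_mu is itself in its nilpotent commutator, it is
    generic there (generic_superdistinct).

    Generic types have gaps. Let mu be generic for lam, and let lam have m parts.
    Over a finite field with q elements, count the nilpotent C that commute with
    J_mu and have type lam. The pairs of commuting matrices of types mu and lam
    can be counted by fixing either member, and since a general element of
    jnil lam has type mu this yields at least a constant times q^(z - m) such C,
    where q^z is the number of endomorphisms of M_mu (card_omega_ge). On the other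
    hand C has corank m, so it factors as M_mu -> M_nu -> M_mu for a partition nu
    of n - m (jhom_factor), uniquely up to an automorphism of M_nu. Writing c_k
    and c'_k for the numbers of parts of mu and nu that exceed k, there are about
    q^(z - e) endomorphisms factoring in this way, where e is the sum of the
    (c_k - c'_k)^2, and e is at least the sum of the c_k - c'_k, which is m. If mu
    and nu have a common part, then some factored endomorphism is a nonzero
    idempotent, so only a proportion O(1/q) of them is nilpotent. If they have no
    common part and mu has two parts that differ by at most 1, then some
    c_k - c'_k is neither 0 nor 1, and e > m. Hence if mu lacks the gaps, the
    number of C is at most a constant times q^(z - m - 1) (card_omega_le), which
    is absurd for large q (no_generic_type).

    The generic type over F agrees with the generic type over suitable arbitrarily
    large finite fields: it is described by the vanishing of minors, which are
    polynomials with integer coefficients (generic_type_finite). Idempotence is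
    the combination of the last two facts. *)

Set Implicit Arguments.
Unset Strict Implicit.
Unset Printing Implicit Defensive.

Import GRing.Theory.
Local Open Scope ring_scope.

(** * Cells of a partition and entries of Jordan matrices *)

Lemma natb0 (R : pzSemiRingType) (b : bool) : ~~ b -> b%:R = 0 :> R.
Proof. by case: b. Qed.

Section Cells.
Variables (n : nat) (lam : intpart n).

(** The index u of an n x n matrix is viewed as the cell of lam in block blk u at
    place pos u. On row vectors the Jordan matrix sends the cell (i, t) to
    (i, t + 1), and the last cell of each block to 0. *)
Definition blk (u : 'I_n) : nat :=
  tagnat.sig1 (cast_ord (esym (sum_parts lam)) u).

Definition pos (u : 'I_n) : nat :=
  tagnat.sig2 (cast_ord (esym (sum_parts lam)) u).

Lemma blk_lt u : (blk u < size lam)%N.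
Proof. by rewrite /blk. Qed.

Lemma pos_lt u : (pos u < nth 0 lam (blk u))%N.
Proof. by rewrite /pos /blk. Qed.

Lemma nth_size i t : (t < nth 0 lam i)%N -> (i < size lam)%N.
Proof. by case: (ltnP i (size lam)) => // h; rewrite nth_default. Qed.

Definition cell i t (h : (t < nth 0 lam i)%N) : 'I_n :=
  cast_ord (sum_parts lam)
    (@tagnat.Rank (size lam) _ (Ordinal (nth_size h)) (Ordinal h)).

Lemma blk_cell i t (h : (t < nth 0 lam i)%N) : blk (cell h) = i.
Proof. by rewrite /blk /cell cast_ordK tagnat.Rank1K. Qed.

Lemma pos_cell i t (h : (t < nth 0 lam i)%N) : pos (cell h) = t.
Proof. by rewrite /pos /cell cast_ordK tagnat.Rank2K. Qed.

Lemma cell_inj u v : blk u = blk v -> pos u = pos v -> u = v.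
Proof.
move=> hb hp; apply: (@cast_ord_inj _ _ (esym (sum_parts lam))).
apply: ord_inj; rewrite tagnat.rect [in RHS]tagnat.rect.
rewrite -/(pos u) -/(pos v) -hp; congr (_ + _)%N.
by apply: eq_bigl => i; rewrite -/(blk u) -/(blk v) hb.
Qed.

Lemma back_subproof (u : 'I_n) k : (pos u - k < nth 0 lam (blk u))%N.
Proof. exact: leq_ltn_trans (leq_subr _ _) (pos_lt u). Qed.

(** Truncated subtraction keeps the cell in its block. *)
Definition back u k := cell (back_subproof u k).

Lemma blk_back u k : blk (back u k) = blk u. Proof. exact: blk_cell. Qed.
Lemma pos_back u k : pos (back u k) = (pos u - k)%N.
Proof. exact: pos_cell. Qed.

Definition hd u := back u (pos u).

Lemma blk_hd u : blk (hd u) = blk u. Proof. exact: blk_cell. Qed.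
Lemma pos_hd u : pos (hd u) = 0%N. Proof. by rewrite pos_back subnn. Qed.

Lemma parts_sorted : sorted geq lam.
Proof. by case: lam => s /= /and3P[]. Qed.

Lemma part_gt0 i : (i < size lam)%N -> (0 < nth 0 lam i)%N.
Proof.
case: lam => s /= /and3P[_ h0 _] hi.
by rewrite lt0n; apply: contraNneq h0 => <-; apply: mem_nth.
Qed.

Lemma part_mono i j : (i <= j)%N -> (nth 0 lam j <= nth 0 lam i)%N.
Proof.
move=> hij; case: (ltnP j (size lam)) => hj; last by rewrite nth_default.
by apply: (@sorted_leq_nth _ geq _ _ 0%N lam parts_sorted); rewrite ?inE //;
  first [move=> a b c /= h1 h2; exact: leq_trans h2 h1
        | exact: leqnn | exact: leq_ltn_trans hj].
Qed.

(** The first cells of the blocks generate the module. *)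
Definition hdo (i : 'I_(size lam)) : 'I_n := cell (part_gt0 (ltn_ord i)).

Lemma blk_hdo i : blk (hdo i) = i. Proof. exact: blk_cell. Qed.
Lemma pos_hdo i : pos (hdo i) = 0%N. Proof. exact: pos_cell. Qed.

Lemma hdoE u : hdo (Ordinal (blk_lt u)) = hd u.
Proof. by apply: cell_inj; rewrite (blk_hdo, pos_hdo) (blk_hd, pos_hd). Qed.

Lemma hdo_inj : injective hdo.
Proof. by move=> i j /(congr1 blk); rewrite !blk_hdo => /val_inj. Qed.

Lemma pos0_hdo u : pos u = 0%N -> u = hdo (Ordinal (blk_lt u)).
Proof. by move=> h; apply: cell_inj; rewrite (blk_hdo, pos_hdo). Qed.

Lemma part_le_n i : (nth 0 lam i <= n)%N.
Proof.
case: (ltnP i (size lam)) => hi; last by rewrite nth_default.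
by rewrite -[leqRHS](sum_parts lam) (bigD1 (Ordinal hi)) //= leq_addr.
Qed.

End Cells.

Section JordanEntries.
Variable F : fieldType.
Variables (n : nat) (lam : intpart n).
Local Notation J := (jordan_mx F lam).

Lemma jordanE u v :
  J u v = ((blk lam u == blk lam v) && (pos lam v == (pos lam u).+1))%:R.
Proof.
rewrite castmxE mxE val_eqE /blk /pos.
set a := cast_ord _ u; set b := cast_ord _ v.
case: eqVneq => [e|_]; last by rewrite mxE.
have conform p q (epq : p = q) (i : 'I_p) (j : 'I_q) :
    conform_mx (0 : 'M_(p, q)) (jordan_block F p) i j = (j == i.+1 :> nat)%:R.
  by case: q / epq in j *; rewrite conform_mx_id mxE.
by rewrite conform ?e.
Qed.

Lemma jordanXE k u v :
  (J ^+ k) u v = ((blk lam u == blk lam v) && (pos lam v == (pos lam u + k)%N))%:R.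
Proof.
elim: k u v => [|k IH] u v.
  rewrite expr0 mxE addn0; congr (nat_of_bool _)%:R.
  apply/eqP/andP => [->|[/eqP h1 /eqP h2]]; first by rewrite !eqxx.
  exact: (@cell_inj _ lam).
rewrite exprSr mxE.
under eq_bigr => w _ do rewrite IH jordanE -natrM mulnb.
case: (boolP (blk lam u == blk lam v)) => hb /=; last first.
  rewrite big1 // => w _; apply: natb0.
  by apply: contra hb => /andP[/andP[/eqP-> _] /andP[/eqP-> _]].
case: (posnP (pos lam v)) => hv.
  rewrite hv addnS /= big1 // => w _.
  by rewrite !andbF.
rewrite (bigD1 (back lam v 1)) //= blk_back pos_back (eqP hb) eqxx /=.
rewrite subn1 prednK // eqxx andbT addnS big1 ?addr0 => [|w hw].
  by congr (nat_of_bool _)%:R; apply/eqP/eqP; lia.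
apply: natb0; apply: contra hw.
case/andP=> [_ /andP[/eqP h1 /eqP h2]]; apply/eqP/(@cell_inj _ lam).
  by rewrite blk_back.
by rewrite pos_back h2 subn1.
Qed.

Lemma row_jordanX k u (h : (pos lam u + k < nth 0 lam (blk lam u))%N) :
  row u (J ^+ k) = delta_mx 0 (cell h).
Proof.
apply/rowP => v; rewrite !mxE jordanXE eqxx /=; congr (nat_of_bool _)%:R.
apply/andP/eqP => [[/eqP h1 /eqP h2]| ->].
  by apply: (@cell_inj _ lam); rewrite (blk_cell, pos_cell).
by rewrite blk_cell pos_cell !eqxx.
Qed.

Lemma row_jordanX0 k u : (nth 0 lam (blk lam u) <= pos lam u + k)%N ->
  row u (J ^+ k) = 0.
Proof.
move=> h; apply/rowP => v; rewrite !mxE jordanXE.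
case: eqP => //= hb; case: eqP => //= hp.
by move: (pos_lt lam v); rewrite hp -hb ltnNge h.
Qed.

Lemma mul_jordanX m (X : 'M[F]_(m, n)) k i v : (X *m J ^+ k) i v =
  if (k <= pos lam v)%N then X i (back lam v k) else 0.
Proof.
rewrite mxE; under eq_bigr do rewrite jordanXE.
case: leqP => h.
  rewrite (bigD1 (back lam v k)) //= blk_back pos_back eqxx subnK // eqxx mulr1.
  rewrite big1 ?addr0 // => w hw.
  case: eqP => h1 /=; last by rewrite mulr0.
  case: eqP => h2; last by rewrite mulr0.
  case/eqP: hw; apply: (@cell_inj _ lam); first by rewrite blk_back.
  by rewrite pos_back h2 addnK.
rewrite big1 // => w _; case: eqP => /= _; last by rewrite mulr0.
by case: eqP => h2; rewrite ?mulr0 //; lia.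
Qed.

Lemma jordan_nilp : J ^+ n = 0.
Proof.
apply/row_matrixP => u; rewrite row0 row_jordanX0 //.
exact: leq_trans (part_le_n _ _) (leq_addl _ _).
Qed.

End JordanEntries.

(** * Ranks of powers and the Jordan form *)

Section Sums.
Variables (n : nat) (lam : intpart n).

Lemma sum_cells (f : nat -> nat -> nat) :
  (\sum_(u < n) f (blk lam u) (pos lam u) =
   \sum_(i < size lam) \sum_(t < nth 0 lam i) f i t)%N.
Proof.
rewrite sig_big_dep /=.
pose p_ (i : 'I_(size lam)) := nth 0%N lam i.
rewrite (reindex (fun p : {i & 'I_(p_ i)} =>
    cast_ord (sum_parts lam) (tagnat.rank p))) /=.
  apply: eq_big => // p _.
  rewrite /blk /pos cast_ordK tagnat.rankE.
  by congr f; [rewrite tagnat.Rank1K | rewrite tagnat.Rank2K].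
apply: onW_bij; exists (fun u => tagnat.sig (cast_ord (esym (sum_parts lam)) u)).
  by move=> p; rewrite cast_ordK tagnat.rankK.
by move=> u; rewrite tagnat.sigK cast_ordKV.
Qed.

Lemma sum_parts_seq (f : nat -> nat) :
  (\sum_(i < size lam) f (nth 0 lam i) = \sum_(x <- lam) f x)%N.
Proof. by rewrite (big_nth 0%N) big_mkord. Qed.

Lemma sum_parts_n : (\sum_(x <- lam) x)%N = n.
Proof. by rewrite -sum_parts_seq sum_parts. Qed.

Lemma part0 : 0%N \notin parts lam.
Proof. by case: lam => s /= /and3P[]. Qed.

End Sums.

Lemma card_ltn_sub m k : (\sum_(t < m) ((t + k < m) : nat) = m - k)%N.
Proof.
elim: m => [|m IH]; first by rewrite big_ord0.
rewrite big_ord_recl /= add0n; under eq_bigr do rewrite /bump /= addSn ltnS.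
by rewrite IH; lia.
Qed.

Section Ranks.
Variable F : fieldType.
Variables (n : nat) (lam : intpart n).
Local Notation J := (jordan_mx F lam).

(** The nonzero rows of the k-th power are distinct unit vectors, one for each
    cell followed by at least k cells in its block. *)
Lemma rank_jordanX k : \rank (J ^+ k) = (\sum_(x <- lam) (x - k))%N.
Proof.
pose S := [set u : 'I_n | pos lam u + k < nth 0 lam (blk lam u)]%N.
have -> : (\sum_(x <- lam) (x - k))%N = #|S|.
  rewrite -(sum_parts_seq lam (fun x => x - k)%N) -sum1dep_card [RHS]big_mkcond /=.
  have := sum_cells lam (fun i t => (t + k < nth 0 lam i)%N : nat).
  under [X in _ = X -> _]eq_bigr do rewrite card_ltn_sub.
  by move=> <-; apply: eq_bigr => u _; case: ltnP.
pose R : 'M[F]_(#|S|, n) := \matrix_(i < #|S|) row (enum_val i) (J ^+ k).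
have RR : R *m R^T = 1%:M.
  apply/matrixP => i j; rewrite !mxE.
  have := enum_valP i; have := enum_valP j; rewrite !inE => hj hi.
  rewrite (bigD1 (cell hi)) //= !mxE !jordanXE blk_cell pos_cell !eqxx mul1r.
  rewrite big1 ?addr0 => [|w hw].
    congr (nat_of_bool _)%:R; apply/andP/eqP => [[/eqP hb /eqP hp]|->].
      by apply/enum_val_inj/(@cell_inj _ lam) => //; lia.
    by rewrite !eqxx.
  rewrite !mxE !jordanXE natb0 ?mul0r //; apply: contra hw.
  case/andP => /eqP hb /eqP hp; apply/eqP/(@cell_inj _ lam).
    by rewrite blk_cell.
  by rewrite pos_cell.
have rR : \rank R = #|S|.
  apply/eqP; rewrite eqn_leq rank_leq_row /=.
  by have := mxrankM_maxl R R^T; rewrite RR mxrank1.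
rewrite -[RHS]rR; apply/eqP; rewrite eqn_leq.
apply/andP; split; apply: mxrankS; apply/row_subP => u.
  case: (boolP (u \in S)) => hu.
    have -> : row u (J ^+ k) = row (enum_rank_in hu u) R.
      by rewrite rowK enum_rankK_in.
    exact: row_sub.
  by rewrite row_jordanX0 ?sub0mx //; move: hu; rewrite inE -leqNgt.
by rewrite rowK row_sub.
Qed.

End Ranks.

Lemma subn_sumS (s : seq nat) k :
  (\sum_(x <- s) (x - k) =
   \sum_(x <- s) (x - k.+1) + count (ltn k) s)%N.
Proof.
elim: s => [|x s IH]; first by rewrite !big_nil.
by rewrite !big_cons /= IH; case: (ltnP k x) => h; lia.
Qed.

Lemma count_ltnS (s : seq nat) k :
  count (ltn k) s = (count (ltn k.+1) s + count_mem k.+1 s)%N.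
Proof.
elim: s => //= x s ->.
by case: (ltngtP k.+1 x) => h; case: (ltnP k x) => h'; lia.
Qed.

(** The second differences in k of these sums are the multiplicities of the
    parts. *)
Lemma intpart_rank_inj n (lam mu : intpart n) :
  (forall k, (\sum_(x <- lam) (x - k) = \sum_(x <- mu) (x - k))%N) -> lam = mu.
Proof.
move=> h; apply: val_inj => /=.
have hc k : count (ltn k) lam = count (ltn k) mu.
  by have := h k; rewrite subn_sumS (subn_sumS mu) h => /eqP; rewrite eqn_add2l => /eqP.
apply: (@sorted_eq _ geq).
- by move=> a b c /= h1 h2; exact: leq_trans h2 h1.
- by move=> a b; rewrite andbC -eqn_leq => /eqP.
- exact: parts_sorted.
- exact: parts_sorted.
apply/allP => -[|x] _ /=.
  by rewrite !(count_memPn _) ?part0.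
have := hc x; rewrite count_ltnS (count_ltnS mu) hc => /eqP.
by rewrite eqn_add2l.
Qed.

Section JordanForm.
Variables (F : fieldType) (n : nat) (A : 'M[F]_n).

(** A vector v of maximal order in W generates a Krylov space with a stable
    complement: it is cut out in W by the columns A^t w, where w is a linear form
    with v A^k w <> 0. *)
Lemma krylov_split (W : 'M[F]_n) k : (W *m A <= W)%MS ->
    W *m A ^+ k.+1 = 0 -> W *m A ^+ k != 0 ->
  exists v : 'rV[F]_n, exists W' : 'M[F]_n,
    [/\ (v <= W)%MS, (W' <= W)%MS, (W' *m A <= W')%MS,
        \rank W = (k.+1 + \rank W')%N &
        forall m (B : 'M[F]_(m, n)), (W' <= B)%MS ->
          (forall t, (t <= k)%N -> (v *m A ^+ t <= B)%MS) -> (W <= B)%MS].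
Proof.
move=> WA WAk1 WAk.
have [i hi] : exists i, row i (W *m A ^+ k) != 0.
  apply/existsP; apply: contraR WAk; rewrite negb_exists => /forallP h.
  by apply/eqP/row_matrixP => i; rewrite row0; apply/eqP; move: (h i); rewrite negbK.
have [j hj] : exists j, row i (W *m A ^+ k) 0 j != 0.
  apply/existsP; apply: contraR hi; rewrite negb_exists => /forallP h.
  by apply/eqP/rowP => j; rewrite [RHS]mxE; apply/eqP; move: (h j); rewrite negbK.
pose v := row i W.
have hvA t : row i (W *m A ^+ t) = v *m A ^+ t by rewrite row_mul.
rewrite hvA in hj.
pose Y : 'M[F]_(n, k.+1) := \matrix_(a, t) (A ^+ (k - t)) a j.
pose X : 'M[F]_(k.+1, n) := \matrix_(t < k.+1) (v *m A ^+ t).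
have XYE s t : (X *m Y) s t = (v *m A ^+ (s + (k - t))) 0 j.
  rewrite exprD -mulmxE mulmxA [LHS]mxE [RHS]mxE; apply: eq_bigr => a _.
  by rewrite !mxE.
have stabX : (X <= W)%MS.
  apply/row_subP => t; rewrite rowK.
  have: forall u, (u <= W)%MS -> (u *m A ^+ t <= W)%MS; last by apply; exact: row_sub.
  move=> m u hu; elim: {t}(nat_of_ord t) => [|t IH]; first by rewrite expr0 mulmx1.
  by rewrite exprSr -mulmxE mulmxA (submx_trans _ WA) // submxMr.
have vA0 t : (k < t)%N -> v *m A ^+ t = 0.
  move=> ht; rewrite -hvA -(subnKC ht) exprD -mulmxE mulmxA WAk1 mul0mx.
  by rewrite linear0.
(* The columns of Y are in decreasing order of the exponent, which makes the
   Hankel matrix X Y triangular with the constant v A^k w on the diagonal. *)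
have uXY : X *m Y \in unitmx.
  rewrite unitmxE -det_tr det_trig; last first.
    apply/is_trig_mxP => s t hst; rewrite mxE XYE vA0 ?mxE //.
    by have := ltn_ord s; lia.
  rewrite unitfE; apply/prodf_neq0 => t _; rewrite mxE XYE.
  by rewrite subnKC // -ltnS.
have rWY : \rank (W *m Y) = k.+1.
  apply/eqP; rewrite eqn_leq (leq_trans (rank_leq_col _)) //=.
  have rXY : \rank (X *m Y) = k.+1 by exact: mxrank_unit.
  by rewrite -[X in (X <= _)%N]rXY; apply: mxrankS; exact: submxMr.
pose W' := (W :&: kermx Y)%MS.
have YA (u : 'rV[F]_n) : (u <= W)%MS -> u *m Y = 0 -> u *m A *m Y = 0.
  move=> uW uY; apply/rowP => t; rewrite [RHS]mxE.
  have -> : (u *m A *m Y) 0 t = (u *m A ^+ (k - t).+1) 0 j.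
    rewrite exprS -mulmxE mulmxA [LHS]mxE [RHS]mxE.
    by apply: eq_bigr => a _; rewrite !mxE.
  case: (posnP t) => ht.
    rewrite ht subn0; case/submxP: uW => c ->.
    by rewrite -mulmxA WAk1 mulmx0 mxE.
  have ht1 : (t.-1 < k.+1)%N by rewrite prednK // ltnW.
  have /rowP/(_ (Ordinal ht1)) := uY; rewrite [RHS]mxE => <-.
  rewrite [LHS]mxE [RHS]mxE; apply: eq_bigr => a _; rewrite [Y _ _]mxE /=.
  by congr (_ * (A ^+ _) _ _); have := ltn_ord t; lia.
exists v, W'; split.
- exact: row_sub.
- exact: capmxSl.
- apply/row_subP => a; rewrite row_mul sub_capmx.
  have := row_sub a W'; rewrite sub_capmx => /andP[h1 h2].
  rewrite (submx_trans (submxMr A h1) WA) /=; apply/sub_kermxP/YA => //.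
  exact/sub_kermxP.
- by rewrite -(mxrank_mul_ker W Y) rWY.
move=> m B hW' hv; apply/row_subP => a.
set u := row a W; pose c := u *m Y *m invmx (X *m Y).
have uW : (u <= W)%MS by exact: row_sub.
rewrite -(subrK (c *m X) u) addmx_sub //.
  apply: (submx_trans _ hW'); rewrite sub_capmx; apply/andP; split.
    by rewrite addmx_sub // eqmx_opp (submx_trans (submxMl _ _) stabX).
  by apply/sub_kermxP; rewrite mulmxBl -mulmxA mulmxKV // subrr.
apply: (submx_trans (submxMl _ _)); apply/row_subP => t; rewrite rowK.
by apply: hv; rewrite -ltnS.
Qed.

(** The induction splits off blocks of decreasing lengths, whence the bound on the
    entries of s. Spanning is phrased through arbitrary B that contain the Krylov
    vectors, to avoid double sums of subspaces. *)
Lemma krylov_basis (W : 'M[F]_n) : (W *m A <= W)%MS ->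
    (exists k, W *m A ^+ k = 0) ->
  exists s : seq nat, exists v : nat -> 'rV[F]_n,
    [/\ is_intpart (\rank W) s,
        forall k, W *m A ^+ k = 0 -> all (fun x => x <= k)%N s,
        forall i, (i < size s)%N -> v i *m A ^+ (nth 0 s i) = 0 &
        forall m (B : 'M[F]_(m, n)),
          (forall i t, (t < nth 0 s i)%N -> (v i *m A ^+ t <= B)%MS) ->
          (W <= B)%MS].
Proof.
have [r] := ubnP (\rank W); elim: r W => // r IH W hr WA hk.
case: (eqVneq W 0) => [->|W0].
  exists [::], (fun _ => 0); split => //; first by rewrite mxrank0.
  by move=> m B _; rewrite sub0mx.
have hk' : exists k, W *m A ^+ k == 0 by case: hk => k /eqP; exists k.
have [k kP kmin] := ex_minnP hk'.
case: k => [|k] in kP kmin *.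
  by move: kP; rewrite expr0 mulmx1 (negbTE W0).
have WAk : W *m A ^+ k != 0 by apply/negP => /kmin; rewrite ltnn.
have [v [W' [vW W'W W'A rkW gen]]] := krylov_split WA (eqP kP) WAk.
have W'k l : W *m A ^+ l = 0 -> W' *m A ^+ l = 0.
  move=> h; case/submxP: W'W => c ->.
  by rewrite -mulmxA h mulmx0.
have [||s [vs [sP sk sA sgen]]] := IH W' _ W'A.
- by move: hr; rewrite rkW; lia.
- by exists k.+1; apply/W'k/eqP.
case/and3P: sP => s1 s2 s3.
exists (k.+1 :: s), (fun i => if i is i'.+1 then vs i' else v); split.
- apply/and3P; split => /=.
  + have := sk _ (W'k _ (eqP kP)).
    by case: (s) s1 => //= y s' -> /andP[->].
  + by rewrite inE negb_or s2.
  + by rewrite (eqP s3) rkW.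
- move=> l Wl /=; rewrite kmin ?Wl //=.
  exact/sk/W'k.
- case=> [|i] hi /=; last exact: sA.
  case/submxP: vW => c ->.
  by rewrite -mulmxA (eqP kP) mulmx0.
move=> m B hB; apply: gen => [|t ht]; last exact: (hB 0%N).
by apply: sgen => i t ht; exact: (hB i.+1).
Qed.

Theorem jordan_form : nilpotent_mx A -> exists lam : intpart n,
  exists2 P : 'M[F]_n, P \in unitmx & P *m A = jordan_mx F lam *m P.
Proof.
case=> k Ak.
have [||s [v [sP _ vA gen]]] := @krylov_basis 1%:M.
- by rewrite submx1.
- by exists k; rewrite Ak mulmx0.
rewrite mxrank1 in sP; pose lam := Intpart sP; exists lam.
pose P := \matrix_(u < n) (v (blk lam u) *m A ^+ pos lam u).
exists P.
  rewrite -row_full_unit -sub1mx; apply: gen => i t ht.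
  have -> : v i *m A ^+ t = row (@cell _ lam i t ht) P.
    by rewrite rowK blk_cell pos_cell.
  exact: row_sub.
apply/row_matrixP => u; rewrite row_mul rowK row_mul -mulmxA.
have -> : A ^+ pos lam u *m A = A ^+ (pos lam u).+1 by rewrite exprSr.
case: (ltnP (pos lam u).+1 (nth 0 lam (blk lam u))) => h.
  have h1 : (pos lam u + 1 < nth 0 lam (blk lam u))%N by rewrite addn1.
  rewrite -[jordan_mx F lam]expr1 (row_jordanX F h1) -rowE rowK.
  by rewrite blk_cell pos_cell addn1.
rewrite -[jordan_mx F lam]expr1 (@row_jordanX0 F _ _ 1) ?addn1 // mul0mx.
have -> : (pos lam u).+1 = nth 0 s (blk lam u).
  by apply/eqP; rewrite eqn_leq h (pos_lt lam u).
exact: vA (blk_lt lam u).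
Qed.

End JordanForm.

(** * Homomorphisms between Jordan modules *)

(** The homomorphisms from M_lam to M_mu, acting on row vectors. *)
Definition jhom (F : fieldType) n n' (lam : intpart n) (mu : intpart n') :
    pred 'M[F]_(n, n') :=
  [pred X | jordan_mx F lam *m X == X *m jordan_mx F mu].
Arguments jhom {F n n'} lam mu.

Section Jhom.
Variable F : fieldType.

Lemma jhomX n n' (lam : intpart n) (mu : intpart n') (X : 'M[F]_(n, n')) k :
  X \in jhom lam mu -> jordan_mx F lam ^+ k *m X = X *m jordan_mx F mu ^+ k.
Proof.
move/eqP=> h; elim: k => [|k IH]; first by rewrite !expr0 mulmx1 mul1mx.
by rewrite exprSr -mulmxE -mulmxA h mulmxA IH -mulmxA exprSr.
Qed.

Lemma jhomM n1 n2 n3 (l1 : intpart n1) (l2 : intpart n2) (l3 : intpart n3)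
    (X : 'M[F]_(n1, n2)) (Y : 'M[F]_(n2, n3)) :
  X \in jhom l1 l2 -> Y \in jhom l2 l3 -> X *m Y \in jhom l1 l3.
Proof.
move=> /eqP hX /eqP hY; apply/eqP.
by rewrite mulmxA hX -mulmxA hY mulmxA.
Qed.

Lemma jhom1 n (lam : intpart n) : (1%:M : 'M[F]_n) \in jhom lam lam.
Proof. by apply/eqP; rewrite mulmx1 mul1mx. Qed.

Lemma jhom_jordan n (lam : intpart n) : jordan_mx F lam \in jhom lam lam.
Proof. exact/eqP. Qed.

Lemma jhom_lin n n' (lam : intpart n) (mu : intpart n') a
    (X Y : 'M[F]_(n, n')) :
  X \in jhom lam mu -> Y \in jhom lam mu -> a *: X + Y \in jhom lam mu.
Proof.
move=> /eqP hX /eqP hY; apply/eqP.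
by rewrite mulmxDr mulmxDl -scalemxAr -scalemxAl hX hY.
Qed.

Lemma jhom_inv n (lam : intpart n) (X : 'M[F]_n) :
  X \in unitmx -> X \in jhom lam lam -> invmx X \in jhom lam lam.
Proof.
move=> uX /eqP hX; apply/eqP.
by rewrite -[LHS](mulKmx uX) [X *m _]mulmxA -hX -mulmxA mulmxV // mulmx1.
Qed.

Section Entries.
Variables (n n' : nat) (lam : intpart n) (mu : intpart n') (X : 'M[F]_(n, n')).
Hypothesis hX : X \in jhom lam mu.

(** A homomorphism is determined by the images of the generators. *)
Lemma jhom_shift u v : X u v =
  if (pos lam u <= pos mu v)%N then X (hd lam u) (back mu v (pos lam u)) else 0.
Proof.
rewrite -mul_jordanX -(jhomX _ hX).
have h : (pos lam (hd lam u) + pos lam u < nth 0 lam (blk lam (hd lam u)))%N.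
  by rewrite pos_hd blk_hd pos_lt.
have -> : (jordan_mx F lam ^+ pos lam u *m X) (hd lam u) v =
    row (hd lam u) (jordan_mx F lam ^+ pos lam u *m X) 0 v by rewrite [RHS]mxE.
rewrite row_mul (row_jordanX F h) -rowE mxE; congr (X _ v).
by apply: (@cell_inj _ lam); rewrite (blk_cell, pos_cell) ?blk_hd ?pos_hd.
Qed.

(** The cell (i, t) lies in x^t M_lam and is killed by x^(lam_i - t), so the same
    holds for its image. *)
Lemma jhom_supp u v : X u v != 0 ->
  (pos lam u <= pos mu v)%N /\
  (pos lam u + nth 0 mu (blk mu v) <= pos mu v + nth 0 lam (blk lam u))%N.
Proof.
move=> X0; split.
  by apply: contraR X0; rewrite jhom_shift => /negbTE ->.
rewrite leqNgt; apply: contra X0 => hlt; apply/eqP.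
have hu := pos_lt lam u; pose k := (nth 0 lam (blk lam u) - pos lam u)%N.
have hv : (pos mu v + k < nth 0 mu (blk mu v))%N by rewrite /k; lia.
have : (X *m jordan_mx F mu ^+ k) u (cell hv) = 0.
  rewrite -(jhomX _ hX).
  have -> : (jordan_mx F lam ^+ k *m X) u (cell hv) =
    row u (jordan_mx F lam ^+ k *m X) 0 (cell hv) by rewrite [RHS]mxE.
  by rewrite row_mul row_jordanX0 ?mul0mx ?mxE // /k subnKC // ltnW.
rewrite mul_jordanX pos_cell leq_addl => <-; congr (X u _).
by apply: (@cell_inj _ mu); rewrite (blk_back, pos_back) (blk_cell, pos_cell) ?addnK.
Qed.

End Entries.

Lemma jhom_ext n n' (lam : intpart n) (mu : intpart n') (X Y : 'M[F]_(n, n')) :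
  X \in jhom lam mu -> Y \in jhom lam mu ->
  (forall (i : 'I_(size lam)) v, X (hdo i) v = Y (hdo i) v) -> X = Y.
Proof.
move=> hX hY h; apply/matrixP => u v.
by rewrite (jhom_shift hX) (jhom_shift hY) -hdoE h.
Qed.

Lemma sum_hdo n (lam : intpart n) (V : nmodType) (G : 'I_n -> V) :
  (forall w, pos lam w != 0%N -> G w = 0) ->
  \sum_w G w = \sum_(i < size lam) G (hdo i).
Proof.
move=> h; rewrite (bigID (fun w => pos lam w == 0%N)) /=.
rewrite [X in _ + X]big1 ?addr0 //.
rewrite (reindex (@hdo n lam)) /=; first by apply: eq_bigl => i; rewrite pos_hdo.
exists (fun u => Ordinal (blk_lt lam u)) => [i _|u].
  by apply: val_inj; rewrite /= blk_hdo.
by rewrite inE => /eqP /pos0_hdo <-.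
Qed.

Section Endo.
Variables (n : nat) (lam : intpart n).
Local Notation l := (size lam).

(** The action on generators: modulo the radical, e_i goes to the combination of
    the e_j with coefficients topm X i j, and this is multiplicative. *)
Definition topm (X : 'M[F]_n) : 'M[F]_l := \matrix_(i, j) X (hdo i) (hdo j).

Lemma topmM X Y : Y \in jhom lam lam -> topm (X *m Y) = topm X *m topm Y.
Proof.
move=> hY; apply/matrixP => i j; rewrite !mxE (@sum_hdo _ lam).
  by apply: eq_bigr => k _; rewrite !mxE.
move=> w hw; case: (eqVneq (Y w (hdo j)) 0) => [->|]; first by rewrite mulr0.
by move/(jhom_supp hY) => []; rewrite pos_hdo leqn0 (negbTE hw).
Qed.

Lemma topm1 : topm 1%:M = 1%:M.
Proof. by apply/matrixP => i j; rewrite !mxE (inj_eq (@hdo_inj _ lam)). Qed.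

Lemma topmX X k : X \in jhom lam lam -> topm (X ^+ k) = topm X ^+ k.
Proof.
move=> hX; elim: k => [|k IH]; first by rewrite !expr0 topm1.
by rewrite !exprSr -!mulmxE topmM // IH.
Qed.

Lemma topm_incid X i j : X \in jhom lam lam -> topm X i j != 0 ->
  (nth 0 lam j <= nth 0 lam i)%N.
Proof.
by move=> hX; rewrite mxE => /(jhom_supp hX) []; rewrite !pos_hdo !blk_hdo.
Qed.

(** Modulo the radical, these endomorphisms preserve the flag of the spans of
    e_i, e_(i+1), ..., respectively send each member of the flag into the next.
    Both conditions are linear in X. *)
Definition jtri : pred 'M[F]_n := [pred X | (X \in jhom lam lam) &&
  [forall i : 'I_l, forall j : 'I_l, (j < i)%N ==> (topm X i j == 0)]].

Definition jnil : pred 'M[F]_n := [pred X | (X \in jhom lam lam) &&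
  [forall i : 'I_l, forall j : 'I_l, (j <= i)%N ==> (topm X i j == 0)]].

Lemma jtriP X : reflect (X \in jhom lam lam /\
  forall i j : 'I_l, (j < i)%N -> topm X i j = 0) (X \in jtri).
Proof.
apply: (iffP andP) => -[h1 h2]; split => //.
  by move=> i j hij; move/forallP/(_ i)/forallP/(_ j)/implyP/(_ hij)/eqP: h2.
by apply/forallP => i; apply/forallP => j; apply/implyP => hij; rewrite h2.
Qed.

Lemma jnilP X : reflect (X \in jhom lam lam /\
  forall i j : 'I_l, (j <= i)%N -> topm X i j = 0) (X \in jnil).
Proof.
apply: (iffP andP) => -[h1 h2]; split => //.
  by move=> i j hij; move/forallP/(_ i)/forallP/(_ j)/implyP/(_ hij)/eqP: h2.
by apply/forallP => i; apply/forallP => j; apply/implyP => hij; rewrite h2.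
Qed.

Lemma jnil_lin a X Y : X \in jnil -> Y \in jnil -> a *: X + Y \in jnil.
Proof.
move=> /jnilP[hX X0] /jnilP[hY Y0]; apply/jnilP; split; first exact: jhom_lin.
move=> i j hij; have := X0 i j hij; have := Y0 i j hij.
by rewrite !mxE => -> ->; rewrite mulr0 addr0.
Qed.

Lemma jnil0 : 0 \in jnil.
Proof.
apply/jnilP; split=> [|i j _]; last by rewrite !mxE.
by apply/eqP; rewrite mulmx0 mul0mx.
Qed.

Lemma jnil_supp X u v : X \in jnil -> X u v != 0 ->
  [/\ (pos lam u <= pos lam v)%N,
      (pos lam u + nth 0 lam (blk lam v) <= pos lam v + nth 0 lam (blk lam u))%N
    & pos lam u = pos lam v -> (blk lam u < blk lam v)%N].
Proof.
move=> /jnilP[hX X0] Xuv; have [h1 h2] := jhom_supp hX Xuv; split => // e.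
rewrite ltnNge; apply: contra Xuv => hb.
have := X0 (Ordinal (blk_lt lam u)) (Ordinal (blk_lt lam v)) hb.
rewrite mxE !hdoE => <-; rewrite (jhom_shift hX) h1 /hd.
by rewrite {2}e.
Qed.

End Endo.

Lemma expmx_supp n (X : 'M[F]_n) (w : 'I_n -> nat) d k u v :
  (forall u v, X u v != 0 -> (w u + d <= w v)%N) ->
  (X ^+ k) u v != 0 -> (w u + k * d <= w v)%N.
Proof.
move=> h; elim: k u v => [|k IH] u v.
  by rewrite expr0 mxE; case: (u =P v) => [->|]; rewrite ?eqxx // addn0.
rewrite exprSr -mulmxE mxE; case: (boolP [exists a, ((X ^+ k) u a != 0) && (X a v != 0)]).
  by case/existsP => a /andP[/IH h1 /h h2] _; rewrite mulSn; lia.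
rewrite negb_exists => /forallP hn; rewrite big1 ?eqxx // => a _.
have := hn a; rewrite negb_and !negbK => /orP[] /eqP ->; by rewrite ?mul0r ?mulr0.
Qed.

Lemma nilp_supp n (X : 'M[F]_n) (w : 'I_n -> nat) :
  (forall u v, X u v != 0 -> (w u < w v)%N) -> nilpotent_mx X.
Proof.
move=> h; exists (\sum_u w u).+1; apply/matrixP => u v; rewrite [RHS]mxE; apply/eqP.
apply/negPn/negP => h0.
have := @expmx_supp n X w 1 (\sum_u w u).+1 u v; rewrite muln1.
move=> /(_ _ h0) hh; have : (w u + (\sum_u w u).+1 <= w v)%N.
  by apply: hh => a b /h; rewrite addn1.
rewrite (bigD1 v) //=; lia.
Qed.

(** The weight 2t - lam_i of the cell (i, t) is never lowered, and when it is kept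
    the index i of the block is raised. *)
Lemma jnil_nilp n (lam : intpart n) X : X \in jnil lam -> nilpotent_mx X.
Proof.
move=> hX; apply: (@nilp_supp n X
  (fun u => ((pos lam u).*2 + (n - nth 0 lam (blk lam u))) * size lam
            + blk lam u)%N).
move=> u v /(jnil_supp hX) [h1 h2 h3].
have := blk_lt lam u; have := blk_lt lam v.
have := part_le_n lam (blk lam u); have := part_le_n lam (blk lam v).
move: h1 h2 h3; set a := pos _ u; set b := pos _ v; set i := blk _ u.
set j := blk _ v; move=> h1 h2 h3 h4 h5 h6 h7.
case: (ltngtP a b) h1 => // hab _; last first.
  have := h3 hab; rewrite hab in h2 *; nia.
have : (a.*2 + (n - nth 0 lam i) < b.*2 + (n - nth 0 lam j))%N by lia.
nia.
Qed.

End Jhom.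

(** * Triangularization in an incidence algebra *)

Section Incidence.
Variable F : fieldType.

(** For a nonincreasing d these are the block upper triangular matrices whose
    blocks are the level sets of d. *)
Definition incid (d : nat -> nat) r (A : 'M[F]_r) :=
  forall i j, A i j != 0 -> (d j <= d i)%N.

Lemma incidM d r (A B : 'M[F]_r) : incid d A -> incid d B -> incid d (A *m B).
Proof.
move=> hA hB i j; rewrite mxE => h.
have [k] : exists k, A i k * B k j != 0.
  apply/existsP; apply: contraR h; rewrite negb_exists => /forallP h.
  by rewrite big1 // => k _; apply/eqP; have := h k; rewrite negbK.
by rewrite mulf_eq0 negb_or => /andP[/hA h1 /hB h2]; exact: leq_trans h2 h1.
Qed.

Lemma incid1 d r : incid d (1%:M : 'M[F]_r).
Proof. by move=> i j; rewrite mxE; case: (eqVneq i j) => [->|_] //=; rewrite mulr0n eqxx. Qed.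

Lemma incidX d r (A : 'M[F]_r) k : incid d A -> incid d (A ^+ k).
Proof.
move=> hA; elim: k => [|k IH]; first by rewrite expr0; exact: incid1.
by rewrite exprSr -mulmxE; exact: incidM.
Qed.

Lemma incidD d r (A B : 'M[F]_r) : incid d A -> incid d B -> incid d (A + B).
Proof.
move=> hA hB i j; rewrite mxE; case: (eqVneq (A i j) 0) => [->|/hA //].
by rewrite add0r => /hB.
Qed.

Lemma incidZ d r (A : 'M[F]_r) a : incid d A -> incid d (a *: A).
Proof.
by move=> hA i j; rewrite mxE mulf_eq0 negb_or => /andP[_ /hA].
Qed.

(** The column v is a multiple of the last nonzero L^k e_0, and the support of
    L^k e_0 consists of indices where d takes its maximal value d 0. *)
Lemma incid_ker_col (d : nat -> nat) r (L : 'M[F]_r.+1) :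
    (forall i j, (i <= j)%N -> (d j <= d i)%N) -> nilpotent_mx L -> incid d L ->
  exists2 v : 'cV[F]_r.+1, L *m v = 0 &
    exists i1, v i1 0 = 1 /\ forall i, v i 0 != 0 -> d i = d 0%N.
Proof.
move=> dmono [k0 Lk0] hL.
pose e0 : 'cV[F]_r.+1 := delta_mx 0 0.
have ex : exists k, L ^+ k *m e0 == 0 by exists k0; rewrite Lk0 mul0mx.
have [k kP kmin] := ex_minnP ex.
case: k => [|k] in kP kmin *.
  move: kP; rewrite expr0 mul1mx => /eqP/matrixP/(_ 0 0); rewrite !mxE eqxx.
  by move/eqP; rewrite oner_eq0.
have vn0 : L ^+ k *m e0 != 0 by apply/negP => /kmin; rewrite ltnn.
have [i1 hi1] : exists i1, (L ^+ k *m e0) i1 0 != 0.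
  apply/existsP; apply: contraR vn0; rewrite negb_exists => /forallP h.
  apply/eqP/matrixP => i j; rewrite [RHS]mxE ord1; apply/eqP.
  by move: (h i); rewrite negbK.
exists (((L ^+ k *m e0) i1 0)^-1 *: (L ^+ k *m e0)).
  by rewrite -scalemxAr mulmxA mulmxE -exprS (eqP kP) scaler0.
exists i1; split; first by rewrite mxE mulVf.
move=> i; rewrite mxE mulf_eq0 negb_or => /andP[_]; rewrite -colE mxE => h.
by apply/eqP; rewrite eqn_leq dmono //= (incidX hL h).
Qed.

Lemma incid_tperm (d : nat -> nat) r (i j : 'I_r) : d i = d j ->
  incid d (tperm_mx i j : 'M[F]_r).
Proof.
move=> dij a b; rewrite !mxE; case: (tperm i j a =P b) => [<- _|_]; last by rewrite mulr0n eqxx.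
by case: tpermP => [->|->|]; rewrite ?dij.
Qed.

(** A kernel column supported where d is maximal can be made the first basis
    vector by a change of basis inside the incidence algebra; the complementary
    block is treated by induction. *)
Lemma incid_triangularize (d : nat -> nat) r (L : 'M[F]_r) :
    (forall i j, (i <= j)%N -> (d j <= d i)%N) -> nilpotent_mx L -> incid d L ->
  exists h h' : 'M[F]_r, [/\ h *m h' = 1%:M, incid d h, incid d h' &
    forall i j : 'I_r, (j <= i)%N -> (h *m L *m h') i j = 0].
Proof.
elim: r => [|r IH] in d L * => dmono [k Lk] hL.
  exists 1%:M, 1%:M; split; [exact: mulmx1 | exact: incid1 | exact: incid1 | by case].
have [v Lv [i1 [vi1 vd]]] := incid_ker_col dmono (ex_intro _ k Lk) hL.
have d1 : d i1 = d 0%N by apply: vd; rewrite vi1 oner_eq0.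
(* As v i1 = 1, the square of N is 0 and the inverse of 1 + N is 1 - N. The
   column i1 of 1 + N is v, and the transposition T moves it to the front. *)
pose N : 'M[F]_r.+1 := (v - delta_mx i1 0) *m delta_mx 0 i1.
have NE i j : N i j = (v i 0 - (i == i1)%:R) * (j == i1)%:R.
  by rewrite mxE big_ord1 !mxE eqxx andbT.
have NN : N *m N = 0.
  apply/matrixP => i j; rewrite [LHS]mxE [RHS]mxE big1 // => a _; rewrite !NE.
  by case: (eqVneq a i1) => [->|_]; rewrite ?eqxx ?vi1 ?subrr ?mul0r ?mulr0 ?mul0r.
have hN : incid d N.
  move=> i j; rewrite NE; case: (eqVneq j i1) => [->|_]; last by rewrite mulr0 eqxx.
  rewrite mulr1; case: (eqVneq i i1) => [->|_] //.
  by rewrite subr0 => /vd ->; rewrite d1.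
pose T : 'M[F]_r.+1 := tperm_mx 0 i1.
have TT : T *m T = 1%:M by rewrite -perm_mxM tperm2 perm_mx1.
have hT : incid d T by apply: incid_tperm; rewrite d1.
pose h1 := T *m (1%:M - N); pose h1' := (1%:M + N) *m T.
have h11 : h1 *m h1' = 1%:M.
  have NN1 : (1%:M - N) *m (1%:M + N) = 1%:M.
    by rewrite mulmxBl mul1mx mulmxDr mulmx1 NN addr0 addrK.
  by rewrite /h1 /h1' mulmxA -(mulmxA T) NN1 mulmx1.
have hh1 : incid d h1.
  apply: incidM => //; apply: incidD; first exact: incid1.
  by rewrite -scaleN1r; exact: incidZ.
have hh1' : incid d h1' by apply: incidM => //; apply: incidD => //; exact: incid1.
have h1'e : h1' *m delta_mx 0 0 = v.
  have -> : h1' *m delta_mx 0 0 = (1%:M + N) *m delta_mx i1 0 :> 'cV_r.+1.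
    rewrite /h1' -mulmxA; congr (_ *m _); rewrite -colE.
    apply/matrixP => a b; rewrite !mxE ord1 eqxx andbT; congr (nat_of_bool _)%:R.
    case: tpermP => [->|->|/eqP a0 /eqP a1]; rewrite ?eqxx //.
    by rewrite (negbTE a0) (negbTE a1).
  rewrite -colE; apply/matrixP => a b; rewrite ord1 mxE [LHS]mxE mxE NE eqxx mulr1.
  by rewrite addrC subrK.
clearbody h1 h1'; pose L1 := h1 *m L *m h1'.
have L1col i : L1 i 0 = 0.
  have -> : L1 i 0 = (h1 *m (L *m (h1' *m delta_mx 0 0 : 'cV_r.+1))) i 0.
    by rewrite !mulmxA -/L1 -colE [RHS]mxE.
  by rewrite h1'e Lv mulmx0 mxE.
have L1nil : nilpotent_mx L1.
  have h1'1 : h1' *m h1 = 1%:M by apply: mulmx1C.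
  exists k; suff -> : L1 ^+ k = h1 *m L ^+ k *m h1' by rewrite Lk mulmx0 mul0mx.
  elim: (k) => [|m IHm]; first by rewrite !expr0 mulmx1 h11.
  rewrite exprSr IHm -mulmxE /L1 !mulmxA -(mulmxA _ h1' h1) h1'1 mulmx1.
  by rewrite exprSr -mulmxE !mulmxA.
have hL1 : incid d L1 by apply: incidM => //; apply: incidM.
have eqL (A B : 'M[F]_r.+1) : A *m h1 *m L *m (h1' *m B) = A *m L1 *m B.
  by rewrite /L1 !mulmxA.
clearbody L1; pose M : 'M[F]_(1 + r) := L1; pose L2 := drsubmx M.
have ME : M = block_mx 0 (ursubmx M) 0 L2.
  have M0 i : M i (lshift r (0 : 'I_1)) = 0.
    by rewrite -(L1col i); congr (L1 i _); exact: val_inj.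
  rewrite -[LHS]submxK; congr block_mx; apply/matrixP => i j;
    by rewrite [RHS]mxE !mxE (ord1 j) M0.
have [|||h2 [h2' [h22 hh2 hh2' tri2]]] := IH (fun i => d i.+1) L2 _ _ _.
- by move=> i j hij; exact: dmono.
- have Mpow m : exists b c, M ^+ m = block_mx b c 0 (L2 ^+ m).
    elim: m => [|m [b [c e]]].
      by exists 1%:M, 0; rewrite !expr0; exact: (@scalar_mx_block _ 1 r).
    exists (b *m 0 + c *m 0), (b *m ursubmx M + c *m L2).
    rewrite exprSr e -mulmxE [in X in _ *m X]ME mulmx_block.
    by rewrite !mul0mx !mulmx0 !add0r exprSr -mulmxE.
  case: L1nil => m Lm; exists m; have [b [c e]] := Mpow m.
  rewrite -[L2 ^+ m](@block_mxKdr _ 1 r 1 r b c 0) -e /M Lm.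
  by apply/matrixP => i j; rewrite !mxE.
- by move=> i j; rewrite !mxE => /hL1.
have hblk (A : 'M[F]_r) : incid (fun i => d i.+1) A ->
    incid d (block_mx 1%:M 0 0 A : 'M[F]_(1 + r)).
  move=> hA i j; case: (split_ordP i) => i' ->; case: (split_ordP j) => j' ->.
  + by rewrite block_mxEul !ord1.
  + by rewrite block_mxEur mxE eqxx.
  + by rewrite block_mxEdl mxE eqxx.
  + by rewrite block_mxEdr => /hA.
exists ((block_mx 1%:M 0 0 h2 : 'M_(1 + r)) *m h1).
exists (h1' *m (block_mx 1%:M 0 0 h2' : 'M_(1 + r))).
split.
- rewrite mulmxA -(mulmxA _ h1) h11 mulmx1 (@mulmx_block _ 1 r 1 r 1 r).
  rewrite !mul0mx !mulmx0 !mul1mx !addr0 add0r h22.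
  by rewrite -[RHS]/(1%:M : 'M_(1 + r)) [RHS](@scalar_mx_block _ 1 r).
- exact: (incidM (hblk _ hh2) hh1).
- exact: (incidM hh1' (hblk _ hh2')).
move=> i j hij; rewrite eqL -/M ME !(@mulmx_block _ 1 r 1 r 1 r).
rewrite !mul0mx !mulmx0 !mul1mx !addr0 !add0r !mul0mx.
move: hij; case: (@split_ordP 1 r i) => i' ->; case: (@split_ordP 1 r j) => j' ->.
+ by move=> _; rewrite (@block_mxEul _ 1 r 1 r) mxE.
+ by rewrite /= ord1.
+ by move=> _; rewrite (@block_mxEdl _ 1 r 1 r) mxE.
+ by rewrite (@block_mxEdr _ 1 r 1 r) /= ltnS => /tri2.
Qed.

(** Entry (i, j + 1) of the equation expresses h i j times a nonzero entry of u
    through entries of h below row i or left of column j, so the entries of h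
    under the diagonal vanish one after the other, rows from the bottom and
    columns from the left. *)
Lemma upper_intertwiner r (h u u' : 'M[F]_r) :
    (forall i j : 'I_r, (j <= i)%N -> u i j = 0) ->
    (forall i j : 'I_r, (j <= i)%N -> u' i j = 0) ->
    (forall i j : 'I_r, j = i.+1 :> nat -> u i j != 0) ->
    h *m u = u' *m h ->
  forall i j : 'I_r, (j < i)%N -> h i j = 0.
Proof.
move=> tu tu' su hu.
suff main a : forall i j : 'I_r, (r - i <= a)%N -> (j < i)%N -> h i j = 0.
  by move=> i j; apply: (main r); exact: leq_subr.
elim: a => [|a IHa] i j hi; first by have := ltn_ord i; lia.
have [b] := ubnP (j : nat); elim: b j => // b IHb j hjb hji.
have hj1 : (j.+1 < r)%N by exact: leq_ltn_trans hji (ltn_ord i).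
have := congr1 (fun M : 'M_r => M i (Ordinal hj1)) hu.
rewrite /= !mxE (bigD1 j) //= big1 => [|k hk]; last first.
  case: (ltngtP k j) => hkj.
  - by rewrite (IHb k) ?mul0r //; lia.
  - by rewrite tu ?mulr0.
  - by rewrite (val_inj hkj) eqxx in hk.
rewrite addr0 big1 => [|k _]; last first.
  case: (leqP k i) => hki; first by rewrite tu' ?mul0r.
  by rewrite (IHa k) ?mulr0 //=; lia.
by move=> /eqP; rewrite mulf_eq0 (negbTE (su _ _ _)) // orbF => /eqP.
Qed.
End Incidence.

(** * Nilpotent commutators are conjugate into a linear space *)

Section Shift.
Variables (F : fieldType) (n : nat) (lam : intpart n).

Lemma jordan_mull m (Y : 'M[F]_(n, m)) u v :
  forall hu : ((pos lam u).+1 < nth 0 lam (blk lam u))%N,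
  (jordan_mx F lam *m Y) u v = Y (cell hu) v.
Proof.
move=> hu; have h1 : (pos lam u + 1 < nth 0 lam (blk lam u))%N by rewrite addn1.
have -> : (jordan_mx F lam *m Y) u v =
  row u (jordan_mx F lam ^+ 1 *m Y) 0 v by rewrite expr1 [RHS]mxE.
rewrite row_mul (row_jordanX F h1) -rowE mxE; congr (Y _ v).
by apply: (@cell_inj _ lam); rewrite !(blk_cell, pos_cell) ?addn1.
Qed.

Lemma jordan_mull0 m (Y : 'M[F]_(n, m)) u v :
  (nth 0 lam (blk lam u) <= (pos lam u).+1)%N -> (jordan_mx F lam *m Y) u v = 0.
Proof.
move=> hu; have -> : (jordan_mx F lam *m Y) u v =
  row u (jordan_mx F lam ^+ 1 *m Y) 0 v by rewrite expr1 [RHS]mxE.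
by rewrite row_mul row_jordanX0 ?addn1 // mul0mx mxE.
Qed.

Lemma jordan_mulr m (Y : 'M[F]_(m, n)) i v : (Y *m jordan_mx F lam) i v =
  if (0 < pos lam v)%N then Y i (back lam v 1) else 0.
Proof. by rewrite -mul_jordanX expr1. Qed.

End Shift.

Section Lift.
Variable F : fieldType.
Variables (n : nat) (lam : intpart n).
Local Notation l := (size lam).
Local Notation incl := (incid (fun i => nth 0%N lam i)).

(** The matrix h acts on the generators and commutes with x; the incidence
    condition makes this compatible with the relations x^(lam_i) e_i = 0. *)
Definition liftm (h : 'M[F]_l) : 'M[F]_n := \matrix_(u, v)
  if pos lam u == pos lam v
  then h (Ordinal (blk_lt lam u)) (Ordinal (blk_lt lam v)) else 0.

Lemma ord_blk_hdo (i : 'I_l) : Ordinal (blk_lt lam (hdo i)) = i.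
Proof. by apply: val_inj; rewrite /= blk_hdo. Qed.

Lemma liftm_hdo h (i j : 'I_l) : liftm h (hdo i) (hdo j) = h i j.
Proof. by rewrite mxE !pos_hdo eqxx !ord_blk_hdo. Qed.

Lemma liftm_jhom h : incl h -> liftm h \in jhom lam lam.
Proof.
move=> hh; apply/eqP/matrixP => u v; rewrite jordan_mulr.
case: (ltnP (pos lam u).+1 (nth 0%N lam (blk lam u))) => hu.
  rewrite (jordan_mull _ _ hu) mxE pos_cell.
  case: ltnP => hv; last by case: eqP => // e; rewrite -e in hv.
  rewrite mxE pos_back.
  have -> : ((pos lam u).+1 == pos lam v) = (pos lam u == (pos lam v - 1)%N).
    by apply/eqP/eqP; lia.
  by case: eqP => // _; congr (h _ _); apply: val_inj; rewrite /= ?blk_cell ?blk_back.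
rewrite jordan_mull0 //.
case: ltnP => // hv; rewrite mxE pos_back; case: eqP => // e.
apply/esym/eqP/negPn/negP => /hh /=; rewrite blk_back => h1.
by have := pos_lt lam v; move: hu; rewrite e; lia.
Qed.

(** Homomorphisms agree as soon as they agree on generators. *)
Lemma liftmM h h' : incl h -> incl h' -> liftm (h *m h') = liftm h *m liftm h'.
Proof.
move=> hh hh'; apply: (@jhom_ext _ _ _ lam lam).
- exact/liftm_jhom/incidM.
- by apply: jhomM; exact: liftm_jhom.
move=> i v; rewrite [RHS]mxE (@sum_hdo _ lam); last first.
  by move=> w hw; rewrite mxE pos_hdo eq_sym (negbTE hw) mul0r.
rewrite mxE pos_hdo ord_blk_hdo; case: eqP => hv; last first.
  rewrite big1 // => k _; rewrite [liftm h' _ _]mxE pos_hdo.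
  by case: eqP => // _; rewrite mulr0.
rewrite mxE; apply: eq_bigr => k _; rewrite liftm_hdo; congr (_ * _).
by rewrite mxE pos_hdo ord_blk_hdo -hv.
Qed.

Lemma liftm1 : liftm 1%:M = 1%:M.
Proof.
apply/matrixP => u v; rewrite !mxE; case: eqP => hp.
  congr (_ *+ nat_of_bool _); apply/eqP/eqP => [[hb]|-> //].
  exact: (@cell_inj _ lam).
by case: eqP => // e; rewrite e in hp.
Qed.

Lemma topm_liftm h : topm lam (liftm h) = h.
Proof. by apply/matrixP => i j; rewrite mxE liftm_hdo. Qed.

(** It suffices to triangularize the action on the generators, since the change of
    basis lifts to an automorphism of the Jordan module. *)
Lemma jhom_to_jnil (A : 'M[F]_n) : A \in jhom lam lam -> nilpotent_mx A ->
  exists Q Q' : 'M[F]_n, [/\ Q *m Q' = 1%:M, Q \in jhom lam lam,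
     Q' \in jhom lam lam & Q *m A *m Q' \in jnil lam].
Proof.
move=> hA [k Ak].
have [|||h [h' [hh' ih ih' tri]]] :=
  @incid_triangularize F (fun i => nth 0%N lam i) _ (topm lam A).
- exact: part_mono.
- by exists k; rewrite -topmX // Ak; apply/matrixP => i j; rewrite !mxE.
- by move=> i j; exact: topm_incid.
have jh := liftm_jhom ih; have jh' := liftm_jhom ih'.
exists (liftm h), (liftm h'); split => //.
  by rewrite -liftmM // hh' liftm1.
apply/jnilP; split => [|i j hij]; first exact: jhomM (jhomM jh hA) jh'.
by rewrite !topmM // !topm_liftm tri.
Qed.

End Lift.

Section Generic.
Variables (n : nat) (lam : intpart n).

Definition gen_cond (u v : 'I_n) : bool :=
  [&& pos lam u <= pos lam v,
      pos lam u + nth 0 lam (blk lam v) <= pos lam v + nth 0 lam (blk lam u) &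
      (pos lam u == pos lam v) ==> (blk lam u < blk lam v)]%N.

(** An integral linear projection onto jnil: it reads the coefficients of the
    images of the generators off W, and discards those that are not allowed. *)
Definition genm (R : pzSemiRingType) (W : 'M[R]_n) : 'M[R]_n := \matrix_(u, v)
  if gen_cond u v then W (hd lam u) (back lam v (pos lam u)) else 0.

Lemma map_genm (R S : pzRingType) (f : {rmorphism R -> S}) (W : 'M[R]_n) :
  map_mx f (genm W) = genm (map_mx f W).
Proof. by apply/matrixP => u v; rewrite !mxE; case: ifP; rewrite ?rmorph0. Qed.

Variable F : fieldType.

Lemma genm_jnil (W : 'M[F]_n) : genm W \in jnil lam.
Proof.
apply/jnilP; split; last first.
  move=> i j hij; rewrite !mxE /gen_cond !pos_hdo eqxx !blk_hdo /=.
  by rewrite ltnNge hij andbF.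
apply/eqP/matrixP => u v; rewrite jordan_mulr.
case: (ltnP (pos lam u).+1 (nth 0%N lam (blk lam u))) => hu.
  rewrite (jordan_mull _ _ hu) mxE /gen_cond pos_cell blk_cell.
  case: ltnP => //= hv; last first.
    case: ltnP => // hv0; rewrite mxE /gen_cond pos_back.
    by rewrite leqNgt (_ : (pos lam v - 1 < pos lam u)%N) //; lia.
  rewrite [genm _ _ _]mxE /gen_cond pos_back blk_back.
  have -> : ((pos lam u).+1 == pos lam v) = (pos lam u == (pos lam v - 1)%N).
    by apply/eqP/eqP; lia.
  have -> : (pos lam u <= pos lam v - 1)%N by lia.
  have -> : ((pos lam u).+1 + nth 0 lam (blk lam v) <= pos lam v + nth 0 lam (blk lam u))%N
    = (pos lam u + nth 0 lam (blk lam v) <= pos lam v - 1 + nth 0 lam (blk lam u))%N.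
    by apply/idP/idP; lia.
  rewrite (leq_trans _ hv) //=; case: ifP => // _; congr (W _ _); apply: (@cell_inj _ lam).
  - by rewrite !blk_hd blk_cell.
  - by rewrite !pos_hd.
  - by rewrite !blk_back.
  - by rewrite !pos_back; lia.
rewrite jordan_mull0 //.
case: ltnP => // hv; rewrite mxE /gen_cond pos_back blk_back.
case: ifP => // /and3P[_ h _].
by have := pos_lt lam v; lia.
Qed.

Lemma genm_id (X : 'M[F]_n) : X \in jnil lam -> genm X = X.
Proof.
move=> hX; have /jnilP[hX' _] := hX; apply/matrixP => u v; rewrite mxE.
case: (boolP (gen_cond u v)) => h.
  by rewrite (jhom_shift hX' u v); case/andP: h => ->.
apply/esym/eqP; apply: contraR h => /(jnil_supp hX) [h1 h2 h3].
by apply/and3P; split => //; apply/implyP => /eqP.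
Qed.

End Generic.

(** * Partitions with gaps are generic for themselves *)

(** Weighted bound: an operator that raises w by at least d has small rank, since
    its rows of weight at least t are supported on columns of weight at least
    t + d. *)
Lemma rank_supp (F : fieldType) n (X : 'M[F]_n) (w : 'I_n -> nat) t d :
  (forall u v, X u v != 0 -> (w u + d <= w v)%N) ->
  (\rank X <= \sum_u ((w u < t) : nat) + \sum_u ((t + d <= w u) : nat))%N.
Proof.
move=> h; pose D (p : pred 'I_n) : 'M[F]_n := diag_mx (\row_u (p u)%:R).
have rD (p : pred 'I_n) : (\rank (D p) <= \sum_u (p u : nat))%N.
  have -> : D p = \sum_(u | p u) delta_mx u u.
    apply/matrixP => i j; rewrite !mxE summxE.
    case: (eqVneq i j) => [<-|hij].
      case: (boolP (p i)) => hi.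
        rewrite (bigD1 i) //= mxE !eqxx big1 ?addr0 // => k /andP[_ hk].
        by rewrite mxE eq_sym (negbTE hk).
      rewrite mul0rn big1 // => k hk; rewrite mxE.
      by case: (eqVneq i k) => // e; rewrite e hk in hi.
    rewrite mulr0n big1 // => k _; rewrite mxE.
    by case: (eqVneq i k) => // <-; rewrite eq_sym (negbTE hij).
  rewrite [leqRHS](eq_bigr (fun u => if p u then 1 else 0)%N) => [|u _]; last by case: (p u).
  rewrite -big_mkcond /=; elim/big_rec2: _ => [|u M m _ hM]; first by rewrite mxrank0.
  by rewrite (leq_trans (mxrank_add _ _)) // mxrank_delta leq_add2l.
have -> : X = D (fun u => w u < t)%N *m X +
    D (fun u => t <= w u)%N *m X *m D (fun u => t + d <= w u)%N.
  apply/matrixP => i j; rewrite /D !mul_diag_mx mul_mx_diag !mxE.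
  case: ltnP => hi; first by rewrite mul1r !mul0r addr0.
  rewrite mul0r add0r mul1r; case: (eqVneq (X i j) 0) => [->|/h hij].
    by rewrite mul0r.
  by rewrite (leq_trans _ hij) ?mulr1 // leq_add2r.
apply: leq_trans (mxrank_add _ _) _; apply: leq_add.
  by apply: leq_trans (mxrankM_maxl _ _) _; exact: rD.
by apply: leq_trans (mxrankM_maxr _ _) _; exact: rD.
Qed.

Definition superdistinct (s : seq nat) :=
  forall i, (i.+1 < size s)%N -> (2 <= nth 0 s i - nth 0 s i.+1)%N.

Section Stable.
Variable F : fieldType.
Variables (n : nat) (mu : intpart n).
Hypothesis sd : superdistinct mu.

Lemma superdistinct_gap i j : (i < j)%N -> (j < size mu)%N ->
  (nth 0 mu j + 2 <= nth 0 mu i)%N.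
Proof.
move=> hij hj; have := sd (leq_ltn_trans hij hj).
by have := part_mono mu hij; lia.
Qed.

(** The left-hand side counts the s in [0, l) whose centered weight
    2s - l + 1 is at most - k or at least k + 1. *)
Lemma count_window (l k : nat) :
  (\sum_(s < l) ((s.*2 + 1 + k <= l)%N : nat) +
   \sum_(s < l) ((l + k <= s.*2)%N : nat) = l - k)%N.
Proof.
have cnt0 a b m : (a <= b)%N -> (b <= m)%N ->
    (\sum_(s < m) ((a <= s < b)%N : nat) = b - a)%N.
  elim: m b => [|m IH] b hab hbm; first by rewrite big_ord0; lia.
  rewrite big_ord_recr /=; case: (ltnP m b) => hb; last first.
    by rewrite (IH b) // andbF addn0.
  have eb : b = m.+1 by lia.
  rewrite eb andbT; case: (leqP a m) => ham.
    rewrite (eq_bigr (fun s : 'I_m => (a <= s < m)%N : nat)) => [|s _].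
      by rewrite (IH m) //; lia.
    by rewrite ltnS (ltnW (ltn_ord s)) (ltn_ord s).
  rewrite big1 => [|s _]; first by lia.
  by rewrite leqNgt (leq_trans (ltn_ord s)) // ltnW.
have cnt (p : nat -> bool) a b : (a <= b)%N -> (b <= l)%N ->
    (forall s, (s < l)%N -> p s = (a <= s < b)%N) ->
    (\sum_(s < l) (p s : nat) = b - a)%N.
  by move=> hab hbl hp; rewrite -(cnt0 _ _ _ hab hbl); apply: eq_bigr => s _; rewrite hp.
case: (leqP k l) => hk.
  rewrite (cnt (fun s => s.*2 + 1 + k <= l)%N 0%N ((l - k + 1)./2)%N) //;
    [|lia|by move=> s hs; apply/idP/idP; lia].
  rewrite (cnt (fun s => l + k <= s.*2)%N ((l + k + 1)./2)%N l) //; [lia|lia|].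
  by move=> s hs; apply/idP/idP; lia.
rewrite big1 => [|s _]; last by have := ltn_ord s; case: leqP => //; lia.
rewrite big1 => [|s _]; last by have := ltn_ord s; case: leqP => //; lia.
by lia.
Qed.

(** Centering each Jordan block at weight 0, with the shift of degree 2, makes
    every element of jnil raise weights by at least 2: this is where the gaps
    between the parts enter. *)
Lemma jnil_rank_le (X : 'M[F]_n) k : X \in jnil mu ->
  (\rank (X ^+ k) <= \rank (jordan_mx F mu ^+ k))%N.
Proof.
(* The weight is shifted by n to stay in the natural numbers, so that the cut at
   - k becomes a cut at n - k. *)
move=> hX; pose w u := ((pos mu u).*2 + (n - nth 0 mu (blk mu u)))%N.
have hw u v : X u v != 0 -> (w u + 2 <= w v)%N.
  move=> /(jnil_supp hX) [h1 h2 h3]; rewrite /w.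
  have := part_le_n mu (blk mu u); have := part_le_n mu (blk mu v).
  have := blk_lt mu u; have := blk_lt mu v.
  case: (ltngtP (blk mu u) (blk mu v)) => hb hv hu.
  - by have := superdistinct_gap hb hv; lia.
  - have := superdistinct_gap hb hu; lia.
  rewrite hb in h2 h3 *.
  have : pos mu u != pos mu v by apply/eqP => /h3; rewrite ltnn.
  by lia.
case: (leqP n k) => hk.
  suff -> : X ^+ k = 0 by rewrite mxrank0.
  apply/matrixP => u v; rewrite [RHS]mxE; apply/eqP/negPn/negP.
  move/(expmx_supp hw); rewrite /w.
  have := pos_lt mu u; have := pos_lt mu v; have := part_le_n mu (blk mu u).
  by have := part_le_n mu (blk mu v); lia.
apply: leq_trans (rank_supp (n - k) (fun u v => @expmx_supp _ _ X w 2 k u v hw)) _.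
rewrite rank_jordanX -(sum_parts_seq mu (fun x => x - k)%N).
rewrite (@sum_cells _ mu (fun i t => (t.*2 + (n - nth 0 mu i) < n - k)%N : nat)).
rewrite (@sum_cells _ mu (fun i t => (n - k + k * 2 <= t.*2 + (n - nth 0 mu i))%N : nat)).
rewrite -big_split /=; apply: leq_sum => i _; rewrite -(count_window (nth 0%N mu i)).
have hi := part_le_n mu i.
by apply: leq_add; apply: leq_sum => s _; do 2!case: leqP => //=; lia.
Qed.

End Stable.

(** * Ranks along lines and the generic Jordan type *)

Section Minors.

Definition minorX (R : comPzRingType) n r k (f g : 'I_r -> 'I_n) (M : 'M[R]_n) : R :=
  \det (mxsub f g (M ^+ k)).

Lemma map_mxXn (R S : pzRingType) (phi : {rmorphism R -> S}) n (M : 'M[R]_n) k :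
  map_mx phi (M ^+ k) = (map_mx phi M) ^+ k.
Proof.
elim: k => [|k IH]; first by rewrite !expr0 map_mx1.
by rewrite !exprSr -!mulmxE map_mxM IH.
Qed.

Lemma map_minorX (R S : comPzRingType) (phi : {rmorphism R -> S}) n r k
    (f g : 'I_r -> 'I_n) (M : 'M[R]_n) :
  phi (minorX k f g M) = minorX k f g (map_mx phi M).
Proof. by rewrite /minorX -det_map_mx map_mxsub map_mxXn. Qed.

Variable F : fieldType.

Lemma minor_rank m n r (f : 'I_r -> 'I_m) (g : 'I_r -> 'I_n) (M : 'M[F]_(m, n)) :
  \det (mxsub f g M) != 0 -> (r <= \rank M)%N.
Proof.
move=> h; have u : mxsub f g M \in unitmx by rewrite unitmxE unitfE.
rewrite -[leqLHS](mxrank_unit u) mxsubrc.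
have -> : rowsub f (colsub g M) = rowsub f 1%:M *m (colsub g M).
  by rewrite mul_rowsub_mx mul1mx.
apply: leq_trans (mxrankM_maxr _ _) _.
rewrite -mxrank_tr -[leqRHS]mxrank_tr trmx_mxsub.
have -> : rowsub g M^T = rowsub g 1%:M *m M^T by rewrite mul_rowsub_mx mul1mx.
exact: mxrankM_maxr.
Qed.

Lemma rank_minor m n (M : 'M[F]_(m, n)) : exists (f : 'I_(\rank M) -> 'I_m),
  exists (g : 'I_(\rank M) -> 'I_n), \det (mxsub f g M) != 0.
Proof.
pose f := maxrankfun M; pose B := rowsub f M.
have rB : \rank B = \rank M by rewrite eq_maxrowsub.
have full : row_full B^T by rewrite /row_full mxrank_tr rB.
exists f, (fullrankfun full).
have := fullrowsub_unit full; rewrite unitmxE unitfE -det_tr trmx_mxsub trmxK.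
by rewrite /B -mxsub_comp.
Qed.

Lemma minorX_rank n r k (f g : 'I_r -> 'I_n) (M : 'M[F]_n) :
  minorX k f g M != 0 -> (r <= \rank (M ^+ k))%N.
Proof. exact: minor_rank. Qed.

Lemma rank_minorX n k (M : 'M[F]_n) :
  exists f g : 'I_(\rank (M ^+ k)) -> 'I_n, minorX k f g M != 0.
Proof. exact: rank_minor. Qed.

Definition linemx m n (X D : 'M[F]_(m, n)) : 'M[{poly F}]_(m, n) :=
  map_mx polyC X + 'X *: map_mx polyC D.

Lemma horner_linemx m n (X D : 'M[F]_(m, n)) t :
  map_mx (horner_eval t) (linemx X D) = X + t *: D.
Proof.
by apply/matrixP => i j; rewrite !mxE /horner_eval !hornerE.
Qed.

Lemma horner_minorX_line n r k (f g : 'I_r -> 'I_n) (X D : 'M[F]_n) t :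
  (minorX k f g (linemx X D)).[t] = minorX k f g (X + t *: D).
Proof.
by rewrite -[LHS]/(horner_eval t _) map_minorX horner_linemx.
Qed.

(** On a line, ranks are maximal outside of the zeros of finitely many minors. *)
Lemma generic_line_rank n (X D : 'M[F]_n) t0 N : exists2 g : {poly F}, g != 0 &
  forall t, g.[t] != 0 -> forall j, (j < N)%N ->
    (\rank ((X + t0 *: D) ^+ j) <= \rank ((X + t *: D) ^+ j))%N.
Proof.
elim: N => [|N [g g0 gP]]; first by exists 1; rewrite ?oner_eq0.
have [f1 [f2 h]] := rank_minorX N (X + t0 *: D).
pose p := minorX N f1 f2 (linemx X D); exists (g * p).
  rewrite mulf_neq0 //; apply: contraNneq h => p0.
  by rewrite -horner_minorX_line -/p p0 horner0.
move=> t; rewrite hornerM mulf_eq0 negb_or => /andP[gt pt] j.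
rewrite ltnS leq_eqVlt => /predU1P[->|]; last exact: gP.
by apply: (@minorX_rank _ _ _ f1 f2); rewrite -horner_minorX_line.
Qed.

End Minors.

Section Orbits.
Variables (F : fieldType) (n : nat).

Lemma invmx_mul (P Q : 'M[F]_n) : P \in unitmx -> Q \in unitmx ->
  invmx (P *m Q) = invmx Q *m invmx P.
Proof.
move=> uP uQ; have uPQ : P *m Q \in unitmx by rewrite unitmx_mul uP.
by rewrite -[RHS](mulmxK uPQ) !mulmxA mulmxKV // mulVmx // mul1mx.
Qed.

Lemma conjXn (P A : 'M[F]_n) k : P \in unitmx ->
  (P *m A *m invmx P) ^+ k = P *m A ^+ k *m invmx P.
Proof.
move=> uP; elim: k => [|k IH]; first by rewrite !expr0 mulmx1 mulmxV.
by rewrite !exprSr IH -!mulmxE !mulmxA mulmxKV.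
Qed.

Lemma rank_conj (P A : 'M[F]_n) : P \in unitmx ->
  \rank (P *m A *m invmx P) = \rank A.
Proof.
move=> uP; rewrite mxrankMfree ?row_free_unit ?unitmx_inv //.
by rewrite -[LHS]mxrank_tr trmx_mul mxrankMfree ?mxrank_tr // row_free_unit unitmx_tr.
Qed.

Lemma rank_orbit (mu : intpart n) (A : 'M[F]_n) k : jordan_orbit mu A ->
  \rank (A ^+ k) = \rank (jordan_mx F mu ^+ k).
Proof. by case=> P uP ->; rewrite conjXn // rank_conj. Qed.

Lemma orbit_expn (mu : intpart n) (A : 'M[F]_n) : jordan_orbit mu A -> A ^+ n = 0.
Proof. by case=> P uP ->; rewrite conjXn // jordan_nilp mulmx0 mul0mx. Qed.

Lemma orbit_conj (mu : intpart n) (P A : 'M[F]_n) : P \in unitmx ->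
  jordan_orbit mu A -> jordan_orbit mu (P *m A *m invmx P).
Proof.
move=> uP [Q uQ ->]; exists (P *m Q); first by rewrite unitmx_mul uP.
by rewrite invmx_mul // !mulmxA.
Qed.

Lemma nilp_orbit (A : 'M[F]_n) : nilpotent_mx A -> exists mu, jordan_orbit mu A.
Proof.
move=> /jordan_form [mu [P uP h]]; exists mu; exists (invmx P).
  by rewrite unitmx_inv.
by rewrite invmxK -mulmxA -h mulKmx.
Qed.

Lemma orbit_of_ranks (mu : intpart n) (A : 'M[F]_n) : nilpotent_mx A ->
  (forall j, (j < n)%N -> \rank (A ^+ j) = \rank (jordan_mx F mu ^+ j)) ->
  jordan_orbit mu A.
Proof.
move=> /nilp_orbit [nu hnu] h; suff -> : mu = nu by [].
apply: intpart_rank_inj => k; rewrite -!(rank_jordanX F) -(rank_orbit k hnu).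
case: (ltnP k n) => hk; first by rewrite h.
have hz (M : 'M[F]_n) : M ^+ n = 0 -> M ^+ k = 0.
  by move=> M0; rewrite -(subnKC hk) exprD M0 mul0r.
by rewrite !hz ?jordan_nilp // (orbit_expn hnu).
Qed.

End Orbits.

Definition generic_for (F : fieldType) n (lam mu : intpart n) :=
  forall B : 'M[F]_n, jordan_orbit lam B ->
    zariski_dense_in (jordan_orbit mu `&` nilcomm B)%classic (nilcomm B).

Lemma zariski_closureP (F : fieldType) n (S : set 'M[F]_n) (A : 'M[F]_n) :
  zariski_closure S A <->
  (forall p : {mpoly F[n * n]}, (forall M, S M -> p.@[mxvec M 0] = 0) ->
     p.@[mxvec A 0] = 0).
Proof.
split => [h p hp | h Z [[I ->] SZ] p Ip].
  have := h (zero_locus [set p]%classic).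
  apply => //; split; first by exists [set p]%classic.
  by move=> M SM q /= ->; exact: hp.
by apply: h => M /SZ; apply.
Qed.

Definition infinite_field (F : fieldType) :=
  forall p : {poly F}, p != 0 -> exists t, p.[t] != 0.

Lemma closed_infinite (F : closedFieldType) : infinite_field F.
Proof. by move=> p /closed_nonrootP [t]; rewrite rootE; exists t. Qed.

Section GenericType.
Variables (F : fieldType) (n : nat).

Hypothesis F_infinite : infinite_field F.

(** Take u maximizing the sum of the ranks of its powers: on the line from u to u'
    a general point is at least as good as u for every power and as good as u'
    for any chosen one. *)
Lemma jnil_generic (lam : intpart n) : exists2 u : 'M[F]_n, u \in jnil lam &
  forall u' : 'M[F]_n, u' \in jnil lam -> forall j, (j < n)%N ->
    (\rank (u' ^+ j) <= \rank (u ^+ j))%N.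
Proof.
pose S (u : 'M[F]_n) : nat := (\sum_(j < n) \rank (u ^+ nat_of_ord j : 'M[F]_n))%N.
have hS u : (S u <= n * n)%N.
  rewrite -[X in (_ <= X * _)%N]card_ord -sum_nat_const.
  by apply: leq_sum => j _; exact: rank_leq_row.
have [u hu umax] : exists2 u : 'M[F]_n, u \in jnil lam &
    forall u', u' \in jnil lam -> (S u' <= S u)%N.
  suff main m : forall u, u \in jnil lam -> (n * n - S u <= m)%N ->
      exists2 u : 'M[F]_n, u \in jnil lam &
        forall u', u' \in jnil lam -> (S u' <= S u)%N.
    by apply: (main _ 0 (jnil0 F lam)); exact: leqnn.
  elim: m => [|m IH] u hu hm.
    by exists u => // u' _; have := hS u'; lia.
  have [h|/boolp.existsNP [u' /boolp.not_implyP [hu' /negP]]] :=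
      boolp.pselect (forall u', u' \in jnil lam -> (S u' <= S u)%N).
    by exists u.
  by rewrite -ltnNge => lt; apply: (IH u') => //; have := hS u'; lia.
exists u => // u' hu' j hj; rewrite leqNgt; apply/negP => lt.
have [g0 g0n g0P] := generic_line_rank u (u' - u) 0 n.
have [g1 g1n g1P] := generic_line_rank u (u' - u) 1 n.
have [t] := F_infinite (mulf_neq0 g0n g1n).
rewrite hornerM mulf_eq0 negb_or => /andP[/g0P h0 /g1P h1].
rewrite scale0r addr0 in h0; rewrite scale1r addrC subrK in h1.
pose v := u + t *: (u' - u).
have hv : v \in jnil lam.
  rewrite /v addrC; apply: jnil_lin => //.
  by rewrite -scaleN1r addrC; exact: jnil_lin.
have := umax v hv; rewrite leqNgt => /negP; apply.
rewrite /S (bigD1 (Ordinal hj)) //= [ltnRHS](bigD1 (Ordinal hj)) //= -addSn.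
apply: leq_add; first exact: leq_trans lt (h1 j hj).
by apply: leq_sum => i _; exact: h0.
Qed.

Lemma jnil_nilcomm (lam : intpart n) (P u : 'M[F]_n) : P \in unitmx ->
  u \in jnil lam ->
  nilcomm (P *m jordan_mx F lam *m invmx P) (P *m u *m invmx P).
Proof.
move=> uP hu; have [k hk] := jnil_nilp hu; have /jnilP[/eqP hc _] := hu.
split; first by exists k; rewrite conjXn // hk mulmx0 mul0mx.
rewrite /comm_mx !mulmxA !(mulmxKV uP) -(mulmxA P u) -(mulmxA P _ u).
by rewrite -hc.
Qed.

Lemma nilcomm_jnil (lam : intpart n) (P A : 'M[F]_n) : P \in unitmx ->
  nilcomm (P *m jordan_mx F lam *m invmx P) A ->
  exists Q u, [/\ Q \in unitmx, u \in jnil lam, A = Q *m u *m invmx Q &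
    P *m jordan_mx F lam *m invmx P = Q *m jordan_mx F lam *m invmx Q].
Proof.
move=> uP [[k Ak] hc].
pose A' := invmx P *m A *m P.
have PA' : A = P *m A' *m invmx P by rewrite /A' !mulmxA mulmxV // mul1mx mulmxK.
have hA' : A' \in jhom lam lam.
  have e1 : invmx P *m (A *m (P *m jordan_mx F lam *m invmx P)) *m P =
      A' *m jordan_mx F lam by rewrite /A' !mulmxA mulmxKV.
  have e2 : invmx P *m (P *m jordan_mx F lam *m invmx P *m A) *m P =
      jordan_mx F lam *m A' by rewrite /A' !mulmxA mulVmx // mul1mx.
  by apply/eqP; rewrite -e1 -e2 hc.
have nA' : nilpotent_mx A'.
  exists k; rewrite -[A' ^+ k](mulKmx uP) -[P *m _](mulmxKV uP).
  by rewrite -conjXn // -PA' Ak mul0mx mulmx0.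
have [R [R' [RR hR hR' hU]]] := jhom_to_jnil hA' nA'.
have uR : R \in unitmx by case/mulmx1_unit: RR.
have R'E : R' = invmx R by rewrite -[LHS](mulKmx uR) RR mulmx1.
exists (P *m R'), (R *m A' *m R'); split => //.
- by rewrite unitmx_mul uP R'E unitmx_inv.
- rewrite {1}PA' invmx_mul ?R'E ?unitmx_inv // invmxK.
  by rewrite !mulmxA mulmxKV // mulmxKV.
rewrite invmx_mul ?R'E ?unitmx_inv // invmxK -R'E.
by rewrite !mulmxA -(mulmxA P R') -(eqP hR') mulmxA R'E mulmxKV.
Qed.

(** In particular a polynomial function on matrices is polynomial along lines. *)
Lemma meval_line (p : {mpoly F[n * n]}) (M : 'M[{poly F}]_n) :
  exists q : {poly F}, forall t, q.[t] = p.@[mxvec (map_mx (horner_eval t) M) 0].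
Proof.
exists (mmap polyC (mxvec M 0) p) => t.
rewrite /meval /mmap horner_sum; apply: eq_bigr => m _.
rewrite hornerM hornerC; congr (_ * _); rewrite /mmap1 horner_prod.
apply: eq_bigr => i _; rewrite horner_exp; congr (_ ^+ _).
by case/mxvec_indexP: i => i j; rewrite !mxvecE mxE.
Qed.

(** If p vanishes on the matrices of type mu in the commutator, then it vanishes at
    the general points of the line joining a conjugate of the best element of
    jnil lam to a given element, and hence on the whole line. *)
Lemma generic_exists (lam : intpart n) : exists mu, generic_for F lam mu.
Proof.
have [u hu umax] := jnil_generic lam.
have [mu hmu] := nilp_orbit (jnil_nilp hu).
exists mu => B [P uP ->]; split; first by move=> A [].
move=> A /(nilcomm_jnil uP) [Q [u' [uQ hu' -> ->]]].
apply/zariski_closureP => p hp.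
have [g g0 gP] := generic_line_rank u (u' - u) 0 n.
have [q qP] := meval_line p (map_mx polyC Q *m linemx u (u' - u) *m map_mx polyC (invmx Q)).
have qE t : q.[t] = p.@[mxvec (Q *m (u + t *: (u' - u)) *m invmx Q) 0].
  rewrite qP !map_mxM /= horner_linemx; congr (p.@[mxvec (_ *m _ *m _) 0]);
    by apply/matrixP => i j; rewrite !mxE /horner_eval hornerC.
have: q * g = 0.
  apply/eqP; apply/negPn/negP => /F_infinite [t].
  rewrite hornerM mulf_eq0 negb_or => /andP[qt gt]; case/eqP: qt; rewrite qE.
  have ht : u + t *: (u' - u) \in jnil lam.
    rewrite addrC; apply: jnil_lin => //.
    by rewrite -scaleN1r addrC; exact: jnil_lin.
  apply: hp; split; last exact: jnil_nilcomm.
  apply: orbit_conj => //; apply: orbit_of_ranks; first exact: jnil_nilp ht.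
  move=> j hj; apply/eqP; rewrite eqn_leq -(rank_orbit j hmu) umax //=.
  by have := gP t gt j hj; rewrite scale0r addr0.
move/eqP; rewrite mulf_eq0 (negbTE g0) orbF => /eqP q0.
by have := qE 1; rewrite q0 horner0 scale1r addrC subrK => <-.
Qed.

(** A minor of size larger than the rank of the j-th power of the Jordan matrix of
    mu vanishes on the dense subset, hence everywhere. *)
Lemma generic_jnil (lam mu : intpart n) : generic_for F lam mu ->
  (exists2 u : 'M[F]_n, u \in jnil lam & jordan_orbit mu u) /\
  (forall u : 'M[F]_n, u \in jnil lam -> forall j,
      (\rank (u ^+ j) <= \rank (jordan_mx F mu ^+ j))%N).
Proof.
have J1 : jordan_mx F lam = 1%:M *m jordan_mx F lam *m invmx 1%:M.
  by rewrite invmx1 mulmx1 mul1mx.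
have u1 : (1%:M : 'M[F]_n) \in unitmx by rewrite unitmx1.
move=> /(_ (jordan_mx F lam)) []; first by exists 1%:M.
move=> _ hcl; split.
  have [A [hA hN]] : exists A, (jordan_orbit mu `&` nilcomm (jordan_mx F lam))%classic A.
    apply: boolp.contrapT => hno.
    have : nilcomm (jordan_mx F lam) 0.
      by split; [exists 1%N; rewrite expr1 | rewrite /comm_mx mul0mx mulmx0].
    move/hcl/zariski_closureP => /(_ 1) h; have := oner_neq0 F.
    rewrite -(meval1 (mxvec (0 : 'M[F]_n) 0)) h ?eqxx // => M hM.
    by case: hno; exists M.
  rewrite J1 in hN; have [Q [u [uQ hu eA _]]] := nilcomm_jnil u1 hN.
  exists u => //; have -> : u = invmx Q *m A *m invmx (invmx Q).
    by rewrite eA invmxK !mulmxA mulVmx // mul1mx mulmxKV.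
  by apply: orbit_conj; rewrite ?unitmx_inv.
move=> u hu j; have [f [g h]] := rank_minorX j u.
rewrite leqNgt; apply: contra h => hlt; apply/eqP.
pose G : 'M[{mpoly F[n * n]}]_n := \matrix_(a, b) 'X_(mxvec_index a b).
have GE (M : 'M[F]_n) : (minorX j f g G).@[mxvec M 0] = minorX j f g M.
  rewrite map_minorX; congr minorX; apply/matrixP => a b.
  by rewrite !mxE /= mevalXU mxvecE.
rewrite -GE; have /hcl/zariski_closureP : nilcomm (jordan_mx F lam) u.
  by have := jnil_nilcomm u1 hu; rewrite -J1 invmx1 mulmx1 mul1mx.
apply => M [hM _]; rewrite GE; apply/eqP/negPn/negP => /minorX_rank.
by rewrite (rank_orbit j hM) leqNgt hlt.
Qed.

Lemma jordan_jnil (lam : intpart n) : jordan_mx F lam \in jnil lam.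
Proof.
apply/jnilP; split=> [|i j hij]; first exact: jhom_jordan.
by rewrite mxE jordanE !pos_hdo andbF.
Qed.

(** The Jordan matrix of mu belongs to jnil mu, so the generic ranks are at least
    those of type mu, and they are at most those by the weighted bound. *)
Lemma generic_superdistinct (mu nu : intpart n) : superdistinct mu ->
  generic_for F mu nu -> nu = mu.
Proof.
move=> sd /generic_jnil [[u hu hnu] hle]; apply: intpart_rank_inj => k.
rewrite -!(rank_jordanX F); apply/eqP; rewrite eqn_leq hle ?jordan_jnil // andbT.
by rewrite -(rank_orbit k hnu) jnil_rank_le.
Qed.

End GenericType.

(** * Dimensions of spaces of homomorphisms *)

(** The dimension of the space of homomorphisms between the Jordan modules of s
    and t. *)
Definition homdim (s t : seq nat) : nat :=
  (\sum_(x <- s) \sum_(y <- t) minn x y)%N.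

(** This turns the dimension into the sum over k of the products of the numbers of
    parts of s and of t that exceed k. *)
Lemma minn_sum K x y : (x <= K)%N ->
  minn x y = (\sum_(k < K) ((k < x) : nat) * ((k < y) : nat))%N.
Proof.
elim: K x y => [|K IH] x y hx; first by rewrite big_ord0; lia.
rewrite big_ord_recr /=; case: (ltnP K x) => hK; last first.
  by rewrite -IH // addn0.
have -> : x = K.+1 by lia.
rewrite (eq_bigr (fun k : 'I_K => ((k < K) : nat) * ((k < y) : nat)))%N; last first.
  by move=> k _; rewrite ltnS (ltn_ord k) (ltnW (ltn_ord k)).
by rewrite -IH // mul1n; case: ltnP; lia.
Qed.

Lemma count_sum (s : seq nat) k :
  count (ltn k) s = (\sum_(x <- s) ((k < x) : nat))%N.
Proof. by elim: s => [|x s IH]; rewrite ?big_nil ?big_cons //= IH. Qed.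

Lemma homdimE K s t : all (fun x => x <= K)%N s ->
  homdim s t = (\sum_(k < K) count (ltn k) s * count (ltn k) t)%N.
Proof.
move=> /allP hs.
rewrite /homdim (eq_big_seq (fun x => \sum_(k < K)
   ((k < x) : nat) * \sum_(y <- t) ((k < y) : nat))%N) => [|x xs].
  rewrite exchange_big /=; apply: eq_bigr => k _.
  by rewrite -big_distrl /= -!count_sum.
rewrite (eq_bigr (fun y => \sum_(k < K) ((k < x) : nat) * ((k < y) : nat)))%N.
  by rewrite exchange_big /=; apply: eq_bigr => k _; rewrite big_distrr.
by move=> y _; rewrite (@minn_sum K) ?hs.
Qed.

Lemma sum_count K (s : seq nat) : all (fun x => x <= K)%N s ->
  (\sum_(k < K) count (ltn k) s = \sum_(x <- s) x)%N.
Proof.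
move=> hs; have := @homdimE K s [:: K] hs.
have -> : homdim s [:: K] = (\sum_(x <- s) x)%N.
  apply: eq_big_seq => x xs; rewrite big_cons big_nil addn0.
  by have := allP hs x xs; lia.
by move=> ->; apply: eq_bigr => k _; rewrite /= addn0 (ltn_ord k) muln1.
Qed.

Lemma ltn_count (s : seq nat) k i : sorted geq s ->
  (i < count (ltn k) s)%N = (k < nth 0 s i)%N.
Proof.
elim: s i => [|x s IH] i; first by rewrite nth_nil.
move=> /= hp; have hs := path_sorted hp.
have hx : all (geq x) s.
  by apply: order_path_min hp => a b c /= h1 h2; exact: leq_trans h2 h1.
case: (ltnP k x) => h; first by case: i => [|i] //=; rewrite add1n ltnS IH.
have -> : count (ltn k) s = 0%N.
  apply/eqP; rewrite -leqn0 leqNgt -has_count; apply/hasPn => y /(allP hx) /=.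
  by rewrite -leqNgt => /leq_trans; apply.
case: i => [|i] /=; first by lia.
case: (ltnP i (size s)) => hi; last by rewrite nth_default.
by have := allP hx _ (mem_nth 0%N hi); rewrite /=; lia.
Qed.

Lemma parts_le n (lam : intpart n) K : (n <= K)%N -> all (fun x => x <= K)%N lam.
Proof.
move=> hK; apply/(all_nthP 0%N) => i _.
exact: leq_trans (part_le_n lam i) hK.
Qed.

Lemma sum_count_parts n (lam : intpart n) K : (n <= K)%N ->
  n = (\sum_(k < K) count (ltn k) lam)%N.
Proof. by move=> hK; rewrite sum_count ?parts_le // sum_parts_n. Qed.

Lemma sqr_sub_ge a b : (2 * (a * b) + a <= a * a + b * b + b)%N.
Proof.
case: (leqP a b) => h.
  have [d ->] : exists d, b = (a + d)%N by exists (b - a)%N; lia.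
  nia.
have [d ->] : exists d, a = (b + d.+1)%N by exists (a - b.+1)%N; lia.
nia.
Qed.

Lemma sqr_sub_eq a b : (2 * (a * b) + a = a * a + b * b + b)%N ->
  a = b \/ a = b.+1.
Proof.
case: (leqP a b) => h.
  have [d ->] : exists d, b = (a + d)%N by exists (b - a)%N; lia.
  by move=> e; left; nia.
have [d ->] : exists d, a = (b + d.+1)%N by exists (a - b.+1)%N; lia.
by move=> e; right; nia.
Qed.

(** With c_k and c'_k the numbers of parts of mu and nu that exceed k, the
    difference of the two sides is the sum of (c_k - c'_k)^2 - (c_k - c'_k),
    a sum of products of two consecutive integers. *)
Lemma homdim_le n n' (mu : intpart n) (nu : intpart n') :
  (2 * homdim mu nu + n <= homdim mu mu + homdim nu nu + n')%N.
Proof.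
pose K := (n + n')%N.
rewrite !(@homdimE K) ?parts_le ?leq_addr ?leq_addl //.
rewrite [X in (_ + X <= _)%N](sum_count_parts mu (leq_addr n' n)).
rewrite [X in (_ <= _ + X)%N](sum_count_parts nu (leq_addl n n')).
rewrite big_distrr -!big_split /=.
by apply: leq_sum => k _; exact: sqr_sub_ge.
Qed.

(** Equality forces all c_k - c'_k to be 0 or 1. Two parts of mu that differ by
    at most 1 make c_k drop by 2 over a range of values none of which is a part
    of nu when nu has no part in common with mu. *)
Lemma homdim_lt n n' (mu : intpart n) (nu : intpart n') :
  ~ superdistinct mu -> ~~ has (mem (parts nu)) mu ->
  (2 * homdim mu nu + n < homdim mu mu + homdim nu nu + n')%N.
Proof.
move=> nsd hno; rewrite ltnNge; apply/negP => hge.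
have {nsd}[i [hi hgap]] : exists i, (i.+1 < size mu)%N /\
    (nth 0 mu i - nth 0 mu i.+1 < 2)%N.
  apply: boolp.contrapT => h; apply: nsd => i hi; rewrite leqNgt; apply/negP => hlt.
  by apply: h; exists i.
pose K := (n + n')%N.
have hall (k : 'I_K) :
    (2 * (count (ltn k) mu * count (ltn k) nu) + count (ltn k) mu =
     count (ltn k) mu * count (ltn k) mu + count (ltn k) nu * count (ltn k) nu
       + count (ltn k) nu)%N.
  move: hge; rewrite !(@homdimE K) ?parts_le ?leq_addr ?leq_addl //.
  rewrite [X in (_ <= _ + X)%N](sum_count_parts mu (leq_addr n' n)).
  rewrite [X in (_ + X <= _)%N](sum_count_parts nu (leq_addl n n')).
  rewrite big_distrr -!big_split /=.
  move=> hge; apply/eqP.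
  have [hle heq] := leqif_sum (P := xpredT) (fun (j : 'I_K) _ =>
    leqif_eq (sqr_sub_ge (count (ltn j) mu) (count (ltn j) nu))).
  move: heq; rewrite (eqn_leq (\sum_i _)) hle hge /=.
  by move/esym/forall_inP; apply.
set a := nth 0%N mu i in hgap; set b := nth 0%N mu i.+1 in hgap.
have hba : (b <= a)%N by exact: part_mono.
have b0 : (0 < b)%N by exact: part_gt0.
have c1 : (i.+1 < count (ltn b.-1) mu)%N.
  by rewrite ltn_count ?parts_sorted // prednK.
have c2 : (count (ltn a) mu <= i)%N.
  by rewrite leqNgt ltn_count ?parts_sorted // ltnn.
have notin x : x \in parts mu -> count_mem x nu = 0%N.
  move=> hx; apply/count_memPn; apply: contra hno => hx'.
  by apply/hasP; exists x.
have ain : a \in parts mu by apply: mem_nth; exact: ltnW.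
have bin : b \in parts mu by exact: mem_nth.
have c3 : count (ltn b.-1) nu = count (ltn a) nu.
  rewrite count_ltnS prednK // notin // addn0.
  have [->//|hab] : a = b \/ a = b.+1 by lia.
  by rewrite count_ltnS -hab notin // addn0.
have aK : (a <= n)%N by exact: part_le_n.
have hb := part_le_n mu i.+1.
have h1 : (b.-1 < K)%N by rewrite /K -/b in hb *; lia.
have e1 := hall (Ordinal h1); rewrite /= in e1.
have e2 : (2 * (count (ltn a) mu * count (ltn a) nu) + count (ltn a) mu =
     count (ltn a) mu * count (ltn a) mu + count (ltn a) nu * count (ltn a) nu
       + count (ltn a) nu)%N.
  case: (ltnP a K) => hK; first exact: (hall (Ordinal hK)).
  have z m (l : intpart m) : (m <= a)%N -> count (ltn a) l = 0%N.
    move=> hm; apply/eqP; rewrite -leqn0 leqNgt ltn_count ?parts_sorted //.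
    by rewrite -leqNgt (leq_trans (part_le_n _ _)).
  by rewrite !z //; move: hK; rewrite /K; lia.
by rewrite c3 in e1; case: (sqr_sub_eq e1); case: (sqr_sub_eq e2); lia.
Qed.

(** * Counting over a finite field *)

Section Counting.
Variable k : finFieldType.
Local Notation q := #|k|.

(** The generator e_i can be sent to any row vector killed by the lam_i-th power of
    the Jordan matrix of mu. *)
Lemma card_jhom n n' (lam : intpart n) (mu : intpart n') :
  #|[set X : 'M[k]_(n, n') | X \in jhom lam mu]| = (q ^ homdim lam mu)%N.
Proof.
pose K (i : 'I_(size lam)) := [set x : 'rV[k]_n' |
  x *m jordan_mx k mu ^+ (nth 0%N lam i) == 0].
pose f (X : 'M[k]_(n, n')) := [ffun i : 'I_(size lam) => row (hdo i) X].
have finj : {in [set X : 'M[k]_(n, n') | X \in jhom lam mu] &, injective f}.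
  move=> X Y; rewrite !inE => hX hY /ffunP e.
  apply: (jhom_ext hX hY) => i v; have := e i; rewrite !ffunE.
  by move/rowP/(_ v); rewrite !mxE.
rewrite -(card_in_imset finj).
have -> : f @: [set X | X \in jhom lam mu] = [set g | g \in family K].
  apply/setP => g; rewrite inE; apply/imsetP/familyP => [[X]|hg].
    rewrite inE => hX -> i; rewrite ffunE inE -row_mul -(jhomX _ hX) row_mul.
    by rewrite row_jordanX0 ?mul0mx // pos_hdo blk_hdo.
  pose X : 'M[k]_(n, n') := \matrix_u
    (g (Ordinal (blk_lt lam u)) *m jordan_mx k mu ^+ pos lam u).
  exists X.
    rewrite inE; apply/eqP/row_matrixP => u; rewrite [RHS]row_mul rowK -mulmxA.
    have -> : jordan_mx k mu ^+ pos lam u *m jordan_mx k mu =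
       jordan_mx k mu ^+ (pos lam u).+1 by rewrite exprSr.
    apply/rowP => v; rewrite mxE.
    case: (ltnP (pos lam u).+1 (nth 0%N lam (blk lam u))) => hu.
      rewrite (jordan_mull _ _ hu) /X mxE pos_cell; congr ((g _ *m _) 0 v).
      by apply: val_inj; rewrite /= blk_cell.
    rewrite jordan_mull0 //; have := hg (Ordinal (blk_lt lam u)); rewrite inE /=.
    have -> : (pos lam u).+1 = nth 0%N lam (blk lam u).
      by apply/eqP; rewrite eqn_leq hu (pos_lt lam u).
    by move/eqP => ->; rewrite mxE.
  apply/ffunP => i; rewrite ffunE rowK pos_hdo expr0 mulmx1; congr (g _).
  by apply: val_inj; rewrite /= blk_hdo.
rewrite cardsE card_family.
have cardK i : #|K i| = (q ^ (\sum_(y <- mu) minn (nth 0 lam i) y))%N.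
  have -> : K i = rowg (kermx (jordan_mx k mu ^+ (nth 0%N lam i))).
    by apply/setP => x; rewrite !inE; apply/eqP/sub_kermxP.
  rewrite card_rowg mxrank_ker rank_jordanX; congr (_ ^ _)%N.
  rewrite -[X in (X - _)%N](sum_parts_n mu).
  elim: (parts mu) => [|y s IH]; first by rewrite !big_nil.
  rewrite !big_cons -IH.
  have : (\sum_(x <- s) (x - nth 0 lam i) <= \sum_(x <- s) x)%N.
    by apply: leq_sum => x _; exact: leq_subr.
  by lia.
rewrite foldrE big_map big_enum /= (eq_bigr _ (fun i _ => cardK i)).
rewrite -expn_sum; congr (_ ^ _)%N.
exact: (sum_parts_seq lam (fun x => \sum_(y <- mu) minn x y)%N).
Qed.

Lemma card_fiber (A B : finType) (D : {set A}) (E : {set B}) (f : A -> B) N :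
  (forall a, a \in D -> f a \in E) ->
  (forall a, a \in D -> (#|[set a' in D | f a' == f a]| <= N)%N) ->
  (#|D| <= N * #|E|)%N.
Proof.
move=> fE fN; rewrite -sum1_card (partition_big f (mem E)) //=.
rewrite mulnC -sum_nat_const; apply: leq_sum => b _.
case: (set_0Vmem [set a in D | f a == b]) => [e0|[a]].
  rewrite big_pred0 // => a; have /setP/(_ a) := e0.
  by rewrite !inE.
rewrite inE => /andP[aD /eqP <-]; apply: leq_trans (fN a aD).
by rewrite sum1dep_card leq_eqVlt; apply/orP; left; apply/eqP; apply: eq_card => x; rewrite !inE.
Qed.

(** In the applications move_to t v is v0 + t v for a point v0 where f does not
    vanish, and p v is the restriction of f to this line. Each line contains at
    most D zeros, and for each t <> 0 the map move_to t permutes S, so summing over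
    t and v counts every zero q - 1 times. *)
Lemma zeros_on_lines (T : finType) (S : {set T}) (move_to : k -> T -> T)
    (f : T -> k) (p : T -> {poly k}) D :
  (forall t v, t != 0 -> v \in S -> move_to t v \in S) ->
  (forall t, t != 0 -> {in S &, injective (move_to t)}) ->
  (forall v, v \in S -> p v != 0 /\ (size (p v) <= D.+1)%N) ->
  (forall t v, v \in S -> f (move_to t v) = (p v).[t]) ->
  ((q - 1) * #|[set v in S | f v == 0%R]| <= D * #|S|)%N.
Proof.
move=> mS minj pP fp; set Z := [set v in S | f v == 0].
have hZ t : t != 0 -> #|Z| = #|[set v in S | (p v).[t] == 0]|.
  move=> t0; rewrite -[RHS](@card_in_imset _ _ (move_to t)); last first.
    by move=> a b; rewrite !inE => /andP[ha _] /andP[hb _]; exact: minj.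
  have mSS : move_to t @: S = S.
    apply/eqP; rewrite eqEcard; apply/andP; split.
      by apply/fintype.subsetP => x /imsetP[v vS ->]; exact: mS.
    by rewrite card_in_imset //; exact: minj.
  apply: eq_card => x; apply/idP/imsetP.
    rewrite inE => /andP[]; rewrite -{1}mSS => /imsetP[v vS ->] fv.
    by exists v => //; rewrite inE vS -fp.
  by case=> v; rewrite inE => /andP[vS pv] ->; rewrite inE mS // fp.
have -> : ((q - 1) * #|Z| = \sum_(t | t != 0%R) \sum_(v in S) ((p v).[t] == 0%R : nat))%N.
  rewrite (eq_bigr (fun _ => #|Z|)) => [|t t0].
    rewrite sum_nat_const; congr (_ * _)%N.
    by rewrite subn1 -(cardC1 (0 : k)); apply: eq_card => t; rewrite !inE.
  rewrite (hZ t t0) -sum1dep_card big_mkcondr /=.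
  by apply: eq_bigr => v _; case: eqP.
rewrite exchange_big /= mulnC -sum_nat_const; apply: leq_sum => v vS.
have [p0 ps] := pP v vS.
rewrite -ltnS; apply: leq_trans ps.
have -> : (\sum_(t | t != 0%R) ((p v).[t] == 0%R : nat) =
   size [seq t <- enum k | (t != 0%R) && root (p v) t])%N.
  rewrite -sum1_size big_filter big_enum_cond /= [RHS]big_mkcondr /=.
  by apply: eq_bigr => t _; rewrite rootE; case: eqP.
apply: max_poly_roots => //.
  by apply/allP => t; rewrite mem_filter => /andP[/andP[]].
by rewrite filter_uniq // enum_uniq.
Qed.

End Counting.

(** * Many matrices of type lam commute with the Jordan matrix of mu *)

Section Degrees.
Variable F : fieldType.

Definition mxsize_le m n d (M : 'M[{poly F}]_(m, n)) :=
  forall i j, (size (M i j) <= d.+1)%N.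

Lemma mxsize_mul m n p a b (A : 'M[{poly F}]_(m, n)) (B : 'M_(n, p)) :
  mxsize_le a A -> mxsize_le b B -> mxsize_le (a + b) (A *m B).
Proof.
move=> hA hB i j; rewrite mxE; apply: leq_trans (size_sum _ _ _) _.
apply/bigmax_leqP => u _; apply: leq_trans (size_polyMleq _ _) _.
have := leq_add (hA i u) (hB u j).
by case: (_ + _)%N => //= x; rewrite addSn addnS ltnS.
Qed.

Lemma mxsize_exp n d k (A : 'M[{poly F}]_n) :
  mxsize_le d A -> mxsize_le (k * d) (A ^+ k).
Proof.
move=> hA; elim: k => [|k IH].
  by move=> i j; rewrite expr0 mxE mul0n; case: (i == j); rewrite ?size_poly1 ?size_poly0.
by rewrite exprSr mulSn addnC; exact: mxsize_mul.
Qed.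

Lemma size_det r d (A : 'M[{poly F}]_r) :
  mxsize_le d A -> (size (\det A) <= (r * d).+1)%N.
Proof.
move=> hA; apply: leq_trans (size_sum _ _ _) _.
apply/bigmax_leqP => s _; rewrite size_Msign.
apply: leq_trans (size_poly_prod_leq _ _) _.
have : (\sum_(i < r) size (A i (s i)) <= r * d.+1)%N.
  rewrite -[X in (_ <= X * _)%N]card_ord -sum_nat_const.
  by apply: leq_sum => i _; exact: hA.
rewrite [X in (_ - X)%N](_ : _ = r); last by rewrite -[RHS]card_ord; exact: eq_card.
by rewrite leq_subLR addnS ltnS -mulnS.
Qed.

Lemma mxsize_line m n (X D : 'M[F]_(m, n)) : mxsize_le 1 (linemx X D).
Proof.
move=> i j; rewrite !mxE; apply: leq_trans (size_polyD _ _) _.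
rewrite geq_max; apply/andP; split; first exact: leq_trans (size_polyC_leq1 _) _.
rewrite mulrC; apply: leq_trans (size_polyMleq _ _) _.
by rewrite size_polyX addn2 /= ltnS size_polyC_leq1.
Qed.

Lemma size_minorX_line n r k (f g : 'I_r -> 'I_n) (X D : 'M[F]_n) :
  (size (minorX k f g (linemx X D)) <= (r * k).+1)%N.
Proof.
apply: size_det => i j; rewrite mxE.
by have := mxsize_exp k (mxsize_line X D); rewrite muln1; apply.
Qed.

End Degrees.

Section LowerBound.
Variable k : finFieldType.
Local Notation q := #|k|.

Lemma zeros_affine m n (S : {set 'M[k]_(m, n)}) (v0 : 'M[k]_(m, n))
    (f : 'M[k]_(m, n) -> k) (p : 'M[k]_(m, n) -> {poly k}) D :
  (forall a X Y, X \in S -> Y \in S -> a *: X + Y \in S) -> v0 \in S ->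
  f v0 != 0 -> (forall v, (size (p v) <= D.+1)%N) ->
  (forall t v, f (v0 + t *: v) = (p v).[t]) ->
  ((q - 1) * #|[set v in S | f v == 0%R]| <= D * #|S|)%N.
Proof.
move=> lS v0S fv0 ps pE.
apply: (@zeros_on_lines k _ S (fun t v => v0 + t *: v) f p) => //.
- by move=> t v _ vS; rewrite addrC; exact: lS.
- by move=> t t0 a b _ _ /addrI; exact: scalerI.
move=> v _; split=> //; apply: contraNneq fv0 => p0.
by have := pE 0 v; rewrite p0 horner0 scale0r addr0 => ->.
Qed.

Definition jaut n (mu : intpart n) : {set 'M[k]_n} :=
  [set X | (X \in jhom mu mu) && (X \in unitmx)].

(** Automorphisms are the complement of the zeros of the determinant, which does
    not vanish at the identity. *)
Lemma card_jaut n (mu : intpart n) : (2 * n.+1 <= q - 1)%N ->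
  (q ^ homdim mu mu <= 2 * #|jaut mu|)%N.
Proof.
move=> hq; rewrite -card_jhom; set S := [set X | _].
have hZ : ((q - 1) * #|[set v in S | \det v == 0%R]| <= n.+1 * #|S|)%N.
  apply: (@zeros_affine _ _ S 1%:M (@determinant _ n) (fun v => \det (linemx 1%:M v))).
  - by move=> a X Y; rewrite !inE; exact: jhom_lin.
  - by rewrite inE jhom1.
  - by rewrite det1 oner_neq0.
  - by move=> v; apply: leq_trans (size_det (mxsize_line _ v)) _; rewrite muln1.
  by move=> t v; rewrite -[RHS]/(horner_eval t _) -det_map_mx horner_linemx.
have hS : #|S| = (#|[set v in S | \det v == 0%R]| + #|jaut mu|)%N.
  rewrite -[LHS](cardsID [set v | \det v == 0] S).
  by congr (_ + _)%N; apply: eq_card => v; rewrite !inE // unitmxE unitfE andbC.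
by rewrite hS in hZ *; nia.
Qed.

Lemma card_cover (T I : finType) (S G : {set T}) (B : I -> {set T}) c N :
  (forall u, u \in S -> u \in G \/ exists i, u \in B i) ->
  (forall i, (c * #|B i| <= N)%N) ->
  (c * #|S| <= c * #|G| + #|I| * N)%N.
Proof.
move=> hc hB; apply: (@leq_trans (c * #|G| + c * \sum_i #|B i|))%N.
  rewrite -mulnDr leq_mul2l; apply/orP; right.
  rewrite -sum1_card -[#|G|]sum1_card big_mkcond /= [X in (_ <= X + _)%N]big_mkcond /=.
  rewrite (eq_bigr (fun i => \sum_u (u \in B i : nat))%N); last first.
    by move=> i _; rewrite -sum1_card big_mkcond /=; apply: eq_bigr => u _; case: (_ \in _).
  rewrite exchange_big -big_split /=; apply: leq_sum => u _.
  case: (boolP (u \in S)) => // /hc [->//|[i hi]].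
  by rewrite (bigD1 i) //= hi; lia.
by rewrite leq_add2l big_distrr -sum_nat_const; apply: leq_sum => i _; exact: hB.
Qed.

Variables (n : nat) (lam : intpart n).

Definition jnilset : {set 'M[k]_n} := [set u | u \in jnil lam].
Definition jtriset : {set 'M[k]_n} := [set u | u \in jtri lam].

(** The diagonal of the action on generators has kernel jnil lam. *)
Lemma card_jtri : (#|jtriset| <= #|jnilset| * q ^ size lam)%N.
Proof.
have -> : (q ^ size lam)%N = #|[set: {ffun 'I_(size lam) -> k}]|.
  by rewrite cardsT card_ffun card_ord.
apply: (@card_fiber _ _ _ _ (fun u => [ffun i => topm lam u i i])) => [u _|u uT].
  by rewrite inE.
set X := [set u' in _ | _].
rewrite -(@card_in_imset _ _ (fun u' => u' - u) X); last by move=> a b _ _ /addIr.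
apply: subset_leq_card; apply/fintype.subsetP => _ /imsetP[u' u'X ->].
move: u'X uT; rewrite !inE => /andP[/jtriP[h1 t1] /eqP/ffunP e] /jtriP[h2 t2].
apply/jnilP; split; first by rewrite addrC -scaleN1r; exact: jhom_lin.
move=> i j; rewrite leq_eqVlt => /orP[/eqP/val_inj eij|hij].
  by have := e i; rewrite !ffunE eij !mxE => ->; rewrite subrr.
by have := t1 i j hij; have := t2 i j hij; rewrite !mxE => -> ->; rewrite subrr.
Qed.

Definition jregular (u : 'M[k]_n) :=
  [forall i : 'I_(size lam), forall j : 'I_(size lam),
     (j == i.+1 :> nat) ==> (topm lam u i j != 0)].

Variable mu : intpart n.

(** The rank condition says that u has type mu; regularity makes upper_intertwiner
    applicable to u. *)
Definition jgood : {set 'M[k]_n} :=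
  [set u : 'M[k]_n | [&& u \in jnil lam, jregular u &
    [forall j : 'I_n, \rank (u ^+ j) == \rank (jordan_mx k mu ^+ j)]]].

(** The excluded elements satisfy one of a bounded number of nontrivial polynomial
    equations: for the ranks these are minors that do not vanish at u1, for the
    superdiagonal the matrix entries. *)
Lemma card_jgood (u1 : 'M[k]_n) : u1 \in jnil lam ->
  (forall j, \rank (jordan_mx k mu ^+ j) <= \rank (u1 ^+ j))%N ->
  (forall u : 'M[k]_n, u \in jnil lam ->
      forall j, \rank (u ^+ j) <= \rank (jordan_mx k mu ^+ j))%N ->
  (2 * ((n + n * n) * (n * n).+1) <= q - 1)%N -> (0 < n)%N ->
  (#|jnilset| <= 2 * #|jgood|)%N.
Proof.
move=> hu1 u1ge ule hq n0.
pose l := size lam.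
pose B (x : 'I_n + 'I_l * 'I_l) : {set 'M[k]_n} := match x with
  | inl j => [set u in jnilset | (\rank (u ^+ nat_of_ord j) < \rank (u1 ^+ nat_of_ord j))%N]
  | inr (i, j) => [set u in jnilset | (i < j)%N && (topm lam u i j == 0)] end.
have lS a (X Y : 'M[k]_n) : X \in jnilset -> Y \in jnilset -> a *: X + Y \in jnilset.
  by rewrite !inE; exact: jnil_lin.
have hB x : ((q - 1) * #|B x| <= (n * n).+1 * #|jnilset|)%N.
  case: x => [j|[i j]] /=.
    have [f [g fg]] := rank_minorX j u1.
    have sub : [set u in jnilset | (\rank (u ^+ j) < \rank (u1 ^+ j))%N] \subset
        [set u in jnilset | minorX j f g u == 0].
      apply/fintype.subsetP => u; rewrite !inE => /andP[-> lt] /=.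
      by apply: contraLR lt => /minorX_rank; rewrite -leqNgt.
    apply: leq_trans (leq_mul (leqnn _) (subset_leq_card sub)) _.
    apply: (@zeros_affine _ _ jnilset u1 (minorX j f g)
      (fun v => minorX j f g (linemx u1 v))) => //.
    - by rewrite inE.
    - move=> v; apply: leq_trans (size_minorX_line _ _ _ _ _) _.
      by rewrite ltnS leqW // leq_mul ?rank_leq_row // ltnW.
    - by move=> t v; rewrite horner_minorX_line.
  case: (ltnP i j) => hij; last first.
    by rewrite [X in (_ * X <= _)%N]eq_card0 ?muln0 // => u; rewrite !inE /= andbF.
  pose v0 := genm lam (const_mx 1 : 'M[k]_n).
  have [h1 h2] : topm lam v0 i j = 1 /\ v0 \in jnilset.
    rewrite inE genm_jnil; split => //; rewrite !mxE /gen_cond !pos_hdo !blk_hdo eqxx /= hij.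
    by rewrite !add0n part_mono ?mxE // ltnW.
  apply: (@zeros_affine _ _ jnilset v0 (fun u => topm lam u i j)
    (fun v => linemx v0 v (hdo i) (hdo j))) => //.
  - by rewrite h1 oner_neq0.
  - by move=> v; apply: leq_trans (mxsize_line _ _ _ _) _.
  move=> t v; have := horner_linemx v0 v t => /matrixP/(_ (hdo i) (hdo j)).
  by rewrite mxE [topm _ _ _ _]mxE => <-.
have hcov : forall u, u \in jnilset -> u \in jgood \/ exists i, u \in B i.
  move=> u hu; case: (boolP (u \in jgood)); first by left.
  have hu' : u \in jnil lam by rewrite inE in hu.
  rewrite inE hu' /= negb_and => /orP[|]; rewrite negb_forall => /existsP[i hi]; right.
    move: hi; rewrite negb_forall => /existsP[j]; rewrite negb_imply negbK => /andP[/eqP e t0].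
    by exists (inr (i, j)); rewrite /B inE hu t0 e ltnSn.
  exists (inl i); rewrite /B inE hu /=; apply: leq_trans (u1ge i).
  by rewrite ltn_neqAle hi ule.
have := card_cover hcov hB; rewrite card_sum card_prod !card_ord => hc.
have hl : (l <= n)%N.
  rewrite -[leqRHS](sum_parts_n lam) /l; elim: (parts lam) (part0 lam) => // x s IH.
  by rewrite inE negb_or big_cons /= => /andP[x0 /IH]; lia.
have hll : ((n + l * l) * ((n * n).+1 * #|jnilset|) <=
    (n + n * n) * (n * n).+1 * #|jnilset|)%N.
  by rewrite mulnA leq_mul2r leq_mul ?orbT // leq_add2l leq_mul.
have c0 : (0 < (n + n * n) * (n * n).+1)%N by rewrite muln_gt0 addn_gt0 n0.
set c := ((n + n * n) * (n * n).+1)%N in hq hll c0.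
have hh : ((q - 1) * #|jnilset| <= (q - 1) * #|jgood| + c * #|jnilset|)%N.
  by apply: leq_trans hc _; rewrite leq_add2l.
nia.
Qed.

Definition omega : {set 'M[k]_n} :=
  [set C | (C \in jhom mu mu) &&
    [exists P : 'M[k]_n, (P \in unitmx) && (C == P *m jordan_mx k lam *m invmx P)]].

Definition frame (u : 'M[k]_n) : 'M[k]_n :=
  odflt 0 [pick P : 'M[k]_n | (P \in unitmx) && (u == P *m jordan_mx k mu *m invmx P)].

Lemma frameP u : u \in jgood ->
  frame u \in unitmx /\ u = frame u *m jordan_mx k mu *m invmx (frame u).
Proof.
rewrite inE => /and3P[hu _ /forallP hr].
have [P uP e] : jordan_orbit mu u.
  apply: orbit_of_ranks; first exact: jnil_nilp hu.
  by move=> j hj; apply/eqP; exact: (hr (Ordinal hj)).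
rewrite /frame; case: pickP => [P' /andP[h1 /eqP h2]//|/(_ P)].
by rewrite uP {1}e eqxx.
Qed.

(** An element a of the automorphism group of the Jordan matrix of mu and a good
    u in jnil lam, put into Jordan form by frame u, transport the Jordan matrix
    of lam to an element of omega. Two such pairs with the same image differ by
    an intertwiner of two good elements, which is triangular. *)
Lemma card_omega_ge : (#|jaut mu| * #|jgood| <= #|jtriset| * #|omega|)%N.
Proof.
rewrite -cardsX.
pose w (x : 'M[k]_n * 'M[k]_n) := x.1 *m invmx (frame x.2).
have wP x : x \in finset.setX (jaut mu) jgood ->
    w x \in unitmx /\ jordan_mx k mu *m w x = w x *m x.2.
  case: x => a u; rewrite finset.in_setX => /andP[/=]; rewrite inE => /andP[/eqP ha ua].
  move=> /frameP [uf e]; split; first by rewrite unitmx_mul ua unitmx_inv.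
  rewrite /w /=; move: (frame u) uf e => P uP ->.
  by rewrite !mulmxA ha mulmxKV.
have winj x y : y \in finset.setX (jaut mu) jgood -> x.2 = y.2 -> w x = w y -> x = y.
  case: x y => [a u] [b v] /= + euv; rewrite euv => /setXP[_ /frameP[uf _]].
  by rewrite /w /= => /(congr1 (mulmxr (frame v))) /=; rewrite !mulmxKV // => ->.
clearbody w; pose f x := w x *m jordan_mx k lam *m invmx (w x).
apply: (@card_fiber _ _ _ _ f) => [x xD|x xD].
  have [uw hw] := wP x xD.
  have hu : x.2 \in jhom lam lam.
    by move: xD; rewrite inE => /andP[_]; rewrite inE => /and3P[/jnilP[]].
  rewrite inE; apply/andP; split; last by apply/existsP; exists (w x); rewrite uw eqxx.
  have hw' : invmx (w x) *m jordan_mx k mu = x.2 *m invmx (w x).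
    have : invmx (w x) *m (jordan_mx k mu *m w x) *m invmx (w x) =
        invmx (w x) *m (w x *m x.2) *m invmx (w x) by rewrite hw.
    by rewrite !mulmxA mulmxK // mulVmx // mul1mx.
  apply/eqP; rewrite /f !mulmxA hw -!mulmxA; congr (_ *m _).
  by rewrite hw' !mulmxA (eqP hu).
have [uw hw] := wP x xD; set X := [set x' in _ | _].
pose h x' := invmx (w x) *m w x'.
have hX x' : x' \in X -> [/\ x' \in finset.setX (jaut mu) jgood,
    h x' *m x'.2 = x.2 *m h x' & h x' \in jhom lam lam].
  rewrite [_ \in X]inE => /andP[x'D /eqP ff].
  have [uw' hw'] := wP x' x'D; split => //.
    rewrite /h -mulmxA -hw' -[x.2](mulKmx uw) -hw.
    by rewrite !mulmxA mulmxK // -!mulmxA mulmxA.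
  apply/eqP; rewrite /h mulmxA.
  have -> : jordan_mx k lam *m invmx (w x) = invmx (w x) *m f x.
    by rewrite /f !mulmxA mulVmx // mul1mx.
  by rewrite -ff /f -!mulmxA mulVmx // mulmx1.
rewrite -(@card_in_imset _ _ h X); last first.
  move=> x1 x2 /hX [x1D e1 _] /hX [x2D e2 _] e.
  have [u1 _] := wP x1 x1D; have [u2 _] := wP x2 x2D.
  have uh : h x1 \in unitmx by rewrite unitmx_mul unitmx_inv uw.
  have e22 : x1.2 = x2.2.
    by rewrite -[LHS](mulKmx uh) e1 e -e2 mulKmx // -e.
  apply: winj => //.
  by move: e => /(congr1 (mulmx (w x))); rewrite /h !mulKVmx.
apply: subset_leq_card; apply/fintype.subsetP => _ /imsetP[x' /hX [x'D e hh] ->].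
rewrite inE; apply/jtriP; split => //.
move: x'D xD; rewrite !inE => /andP[_ /and3P[/jnilP[j1 t1] reg _]].
move=> /andP[_ /and3P[/jnilP[j2 t2] _ _]].
apply: (upper_intertwiner t1 t2).
  move=> i j /eqP hij; move/forallP/(_ i)/forallP/(_ j)/implyP: reg; exact.
by rewrite -!topmM // e.
Qed.

End LowerBound.

(** * Few nilpotent endomorphisms factor when parts are close *)

Section Factor.
Variables (F : fieldType) (n : nat) (mu : intpart n).

(** The row space of an element C of the centralizer is stable under the Jordan
    matrix, which induces a nilpotent operator on it; a Jordan basis for that
    operator factors C through another Jordan module. *)
Lemma jhom_factor r (C : 'M[F]_n) : C \in jhom mu mu -> \rank C = r ->
  exists nu : intpart r, exists pi : 'M[F]_(n, r), exists iota : 'M[F]_(r, n),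
    [/\ pi \in jhom mu nu, iota \in jhom nu mu, row_free iota & C = pi *m iota].
Proof.
move=> /eqP hC e; case: r / e.
pose J := jordan_mx F mu; pose i0 := row_base C; pose p0 := col_base C.
have Cpi : p0 *m i0 = C by exact: mulmx_base.
have fi0 : row_free i0 by exact: row_base_free.
have stab : (i0 *m J <= i0)%MS.
  have i0C : (i0 <= C)%MS by rewrite eq_row_base.
  have Ci0 : (C <= i0)%MS by rewrite eq_row_base.
  apply: submx_trans Ci0; apply: (submx_trans (submxMr J i0C)).
  by rewrite -hC submxMl.
pose J' := i0 *m J *m pinvmx i0.
have J'E : J' *m i0 = i0 *m J by exact: mulmxKpV.
clearbody J'.
have J'nil : nilpotent_mx J'.
  exists n; apply: (row_free_inj fi0); rewrite mul0mx.
  suff -> m : J' ^+ m *m i0 = i0 *m J ^+ m by rewrite jordan_nilp mulmx0.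
  elim: m => [|m IH]; first by rewrite !expr0 mul1mx mulmx1.
  by rewrite exprSr -mulmxE -mulmxA J'E mulmxA IH -mulmxA exprSr.
have [nu [P uP hP]] := jordan_form J'nil.
exists nu, (p0 *m invmx P), (P *m i0).
have Ceq : C = p0 *m invmx P *m (P *m i0) by rewrite mulmxA mulmxKV.
have hi : P *m i0 \in jhom nu mu.
  by apply/eqP; rewrite mulmxA -hP -(mulmxA P) J'E mulmxA.
have fi : row_free (P *m i0).
  by rewrite /row_free mxrankMfree // mxrank_unit.
split=> //; apply/eqP; apply: (row_free_inj fi).
by rewrite -[RHS]mulmxA (eqP hi) -mulmxA -Ceq mulmxA -Ceq.
Qed.

End Factor.

Section CommonPart.
Variables (F : fieldType) (n n' : nat) (mu : intpart n) (nu : intpart n').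

Definition blockid (i j : nat) : 'M[F]_(n, n') := \matrix_(u, v)
  [&& blk mu u == i, blk nu v == j & pos mu u == pos nu v]%:R.

Lemma blockid_jhom i j : nth 0%N mu i = nth 0%N nu j -> blockid i j \in jhom mu nu.
Proof.
move=> e; apply/eqP/matrixP => u v; rewrite jordan_mulr.
case: (ltnP (pos mu u).+1 (nth 0%N mu (blk mu u))) => hu.
  rewrite (jordan_mull _ _ hu) mxE blk_cell pos_cell.
  case: ltnP => hv; last first.
    by apply: natb0; move: hv; rewrite leqn0 => /eqP->; rewrite !andbF.
  rewrite mxE blk_back pos_back; congr (nat_of_bool [&& _, _ & _])%:R.
  by apply/eqP/eqP; lia.
rewrite jordan_mull0 //; case: ltnP => // hv.
rewrite mxE natb0 // blk_back pos_back; apply/negP => /and3P[/eqP h1 /eqP h2 /eqP h3].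
by have := pos_lt nu v; rewrite h2 -e -h1; lia.
Qed.

End CommonPart.

Lemma blockid_mul (F : fieldType) n n' (mu : intpart n) (nu : intpart n') i j u v :
  nth 0%N mu i = nth 0%N nu j ->
  (blockid F mu nu i j *m blockid F nu mu j i) u v = ((blk mu u == i) && (u == v))%:R.
Proof.
move=> e; rewrite mxE; case: (eqVneq (blk mu u) i) => hu /=; last first.
  by rewrite big1 // => w _; rewrite !mxE (negbTE hu) mul0r.
have hw : (pos mu u < nth 0 nu j)%N by rewrite -e -hu pos_lt.
rewrite (bigD1 (cell hw)) //= !mxE blk_cell pos_cell hu !eqxx mul1r /=.
rewrite big1 ?addr0 => [|w hw'].
  congr (nat_of_bool _)%:R; apply/idP/eqP => [/andP[/eqP h1 /eqP h2]|<-].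
    by apply: (@cell_inj _ mu); rewrite ?hu ?h1.
  by rewrite hu !eqxx.
rewrite mxE natb0 ?mul0r //; apply: contra hw' => /and3P[_ /eqP h1 /eqP h2].
by apply/eqP/(@cell_inj _ nu); rewrite (blk_cell, pos_cell).
Qed.

Section UpperBound.
Variables (k : finFieldType) (n : nat) (lam mu : intpart n).
Local Notation q := #|k|.
Hypothesis n_gt0 : (0 < n)%N.

Section OneType.
Variables (r : nat) (nu : intpart r).

(** The second factor is required to be injective on row vectors, so that it
    identifies M_nu with the image of C. *)
Definition through : {set 'M[k]_n} := [set C in omega k lam mu |
  [exists x : 'M[k]_(n, r) * 'M[k]_(r, n), [&& x.1 \in jhom mu nu,
     x.2 \in jhom nu mu, row_free x.2 & C == x.1 *m x.2]]].

Definition homs : {set 'M[k]_(n, r) * 'M[k]_(r, n)} :=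
  [set x | (x.1 \in jhom mu nu) && (x.2 \in jhom nu mu)].

Definition nilhoms : {set 'M[k]_(n, r) * 'M[k]_(r, n)} :=
  [set x in homs | (x.1 *m x.2) ^+ n == 0].

Lemma homdimC s t : homdim s t = homdim t s.
Proof.
rewrite /homdim exchange_big /=; apply: eq_bigr => x _; apply: eq_bigr => y _.
exact: minnC.
Qed.

Lemma card_homs : #|homs| = (q ^ (2 * homdim mu nu))%N.
Proof.
rewrite mul2n -addnn expnD -{1}(card_jhom k mu nu) homdimC -(card_jhom k nu mu).
rewrite -cardsX; apply: eq_card => x.
by rewrite !inE.
Qed.

(** A factorization can be twisted by any automorphism of M_nu, and because the
    second factor is injective the twists are distinct. *)
Lemma card_through : (#|through| * #|jaut k nu| <= #|nilhoms|)%N.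
Proof.
rewrite -cardsX.
pose sel C : 'M[k]_(n, r) * 'M[k]_(r, n) := odflt (0, 0)
  [pick x : 'M[k]_(n, r) * 'M[k]_(r, n) | [&& x.1 \in jhom mu nu,
     x.2 \in jhom nu mu, row_free x.2 & C == x.1 *m x.2]].
have selP C : C \in through -> [/\ (sel C).1 \in jhom mu nu, (sel C).2 \in jhom nu mu,
    row_free (sel C).2 & C = (sel C).1 *m (sel C).2].
  rewrite inE => /andP[_ /existsP[x hx]].
  rewrite /sel; case: pickP => [y /and4P[? ? ? /eqP]//|/(_ x)].
  by rewrite hx.
pose f (y : 'M[k]_n * 'M[k]_r) := ((sel y.1).1 *m y.2, invmx y.2 *m (sel y.1).2).
have fE y : y \in finset.setX through (jaut k nu) -> (f y).1 *m (f y).2 = y.1.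
  case: y => C g /setXP[/selP[_ _ _ e]]; rewrite inE => /andP[_ ug] /=.
  by rewrite -mulmxA mulKVmx // -e.
have finj : {in finset.setX through (jaut k nu) &, injective f}.
  move=> [C g] [C' g'] hy hy' e.
  have eC : C = C' by have := fE _ hy; rewrite e (fE _ hy') => /= ->.
  move: e hy hy'; rewrite eC /f /= => -[_ e2] /setXP[/selP[_ _ fr _]].
  rewrite inE => /andP[_ ug] /setXP[_]; rewrite inE => /andP[_ ug'].
  by congr (_, _); rewrite -[g]invmxK (row_free_inj fr e2) invmxK.
rewrite -(card_in_imset finj); apply: subset_leq_card.
apply/fintype.subsetP => _ /imsetP[y hy ->]; rewrite inE fE //.
case: y hy => C g /setXP[hC]; rewrite inE => /andP[hg ug] /=.
have [h1 h2 _ _] := selP C hC; apply/andP; split.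
  rewrite inE /=; apply/andP; split; first exact: jhomM h1 hg.
  exact: jhomM (jhom_inv ug hg) h2.
move: hC; rewrite inE => /andP[]; rewrite inE => /andP[_ /existsP[P /andP[uP /eqP e]]] _.
by apply/eqP/(@orbit_expn _ _ lam); exists P.
Qed.

(** When mu and nu have a common part, some composite is a nonzero idempotent,
    hence nilpotency of the composite is a nontrivial equation. *)
Lemma card_nilhoms : has (mem (parts nu)) mu ->
  ((q - 1) * #|nilhoms| <= (2 * n) * q ^ (2 * homdim mu nu))%N.
Proof.
case/hasP => x /(nthP 0%N)[i hi ei] /(nthP 0%N)[j hj ej].
have e : nth 0%N mu i = nth 0%N nu j by rewrite ei ej.
pose p0 := blockid k mu nu i j; pose i0 := blockid k nu mu j i.
pose u0 : 'I_n := cell (part_gt0 hi).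
have idem : p0 *m i0 *m (p0 *m i0) = p0 *m i0.
  apply/matrixP => u v; rewrite mxE (bigD1 u) //= big1 => [|w hw].
    by rewrite !blockid_mul // addr0 eqxx andbT; case: (blk mu u == i); rewrite ?mul1r ?mul0r.
  by rewrite blockid_mul // (eq_sym u w) (negbTE hw) andbF mul0r.
have idemX : (p0 *m i0) ^+ n = p0 *m i0.
  rewrite -[X in _ ^+ X](prednK n_gt0); elim: n.-1 => [|m IH]; first by rewrite expr1.
  by rewrite exprSr IH.
pose f (y : 'M[k]_(n, r) * 'M[k]_(r, n)) := ((y.1 *m y.2) ^+ n) u0 u0.
pose move_to t (y : 'M[k]_(n, r) * 'M[k]_(r, n)) := (p0 + t *: y.1, i0 + t *: y.2).
pose p (y : 'M[k]_(n, r) * 'M[k]_(r, n)) := ((linemx p0 y.1 *m linemx i0 y.2) ^+ n) u0 u0.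
have pE t y : f (move_to t y) = (p y).[t].
  rewrite -[RHS]/(horner_eval t (p y)) /p.
  have -> : horner_eval t (((linemx p0 y.1 *m linemx i0 y.2) ^+ n) u0 u0) =
    (map_mx (horner_eval t) ((linemx p0 y.1 *m linemx i0 y.2) ^+ n)) u0 u0 by rewrite mxE.
  by rewrite map_mxXn map_mxM /= !horner_linemx.
have sub : nilhoms \subset [set y in homs | f y == 0].
  apply/fintype.subsetP => y; rewrite !inE => /andP[-> /eqP e0] /=.
  by rewrite /f e0 mxE.
apply: leq_trans (leq_mul (leqnn _) (subset_leq_card sub)) _.
rewrite -card_homs; apply: (@zeros_on_lines k _ homs move_to f p) => //.
- move=> t [a b] _; rewrite /move_to /homs !finset.in_set /= => /andP[ha hb].
  by rewrite [p0 + _]addrC [i0 + _]addrC !jhom_lin ?blockid_jhom.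
- move=> t t0 [a b] [a' b'] _ _ [/addrI /(scalerI t0) -> /addrI /(scalerI t0) ->] //.
- move=> y _; split.
    apply/negP => /eqP p0y; have := pE 0 y; rewrite p0y horner0 /move_to !scale0r !addr0.
    rewrite /f /= idemX blockid_mul // blk_cell !eqxx => /eqP.
    by rewrite oner_eq0.
  apply: leq_trans (mxsize_exp n (mxsize_mul (mxsize_line _ _) (mxsize_line _ _)) _ _) _.
  by rewrite mulnC.
Qed.

(** The two cases gain a factor q - 1: nilpotency is a nontrivial equation when mu
    and nu have a common part, and otherwise homdim_lt improves the exponent. *)
Lemma card_through_le m : (2 * r.+1 <= q - 1)%N -> ~ superdistinct mu ->
  n = (r + m)%N ->
  ((q - 1) * (#|through| * q ^ m) <= (4 * n) * q ^ homdim mu mu)%N.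
Proof.
move=> hq nsd nrm; have hA := card_jaut nu hq; have hT := card_through.
have q0 : (0 < q)%N by rewrite (cardD1 0) inE.
set z := homdim mu mu; set z' := homdim nu nu in hA.
suff main : ((q - 1) * #|through| * q ^ m * q ^ z' <= 4 * n * q ^ z * q ^ z')%N.
  by move: main; rewrite leq_pmul2r ?expn_gt0 ?q0 // !mulnA.
have hT2 : (#|through| * q ^ z' <= 2 * #|nilhoms|)%N.
  apply: leq_trans (leq_mul (leqnn _) hA) _.
  by rewrite mulnCA leq_mul2l hT.
have -> : ((q - 1) * #|through| * q ^ m * q ^ z' =
    (q - 1) * (#|through| * q ^ z') * q ^ m)%N by ring.
case: (boolP (has (mem (parts nu)) mu)) => hc.
  have hN := card_nilhoms hc.
  have hz : (2 * homdim mu nu + m <= z + z')%N.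
    by have := homdim_le mu nu; rewrite -/z -/z'; lia.
  have hqz : (q ^ (2 * homdim mu nu) * q ^ m <= q ^ z * q ^ z')%N.
    by rewrite -!expnD leq_pexp2l.
  apply: (@leq_trans ((q - 1) * (2 * #|nilhoms|) * q ^ m)%N).
    by rewrite leq_mul2r leq_mul2l hT2 !orbT.
  have -> : ((q - 1) * (2 * #|nilhoms|) * q ^ m = 2 * ((q - 1) * #|nilhoms|) * q ^ m)%N by ring.
  apply: (@leq_trans (2 * (2 * n * q ^ (2 * homdim mu nu)) * q ^ m)%N).
    by rewrite leq_mul2r leq_mul2l hN !orbT.
  have -> : (2 * (2 * n * q ^ (2 * homdim mu nu)) * q ^ m =
     4 * n * (q ^ (2 * homdim mu nu) * q ^ m))%N by ring.
  by rewrite -[leqRHS]mulnA leq_mul2l hqz orbT.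
have hz : (2 * homdim mu nu + m.+1 <= z + z')%N.
  by have := homdim_lt nsd hc; rewrite -/z -/z'; lia.
have hqz : (q ^ (2 * homdim mu nu) * q ^ m.+1 <= q ^ z * q ^ z')%N.
  by rewrite -!expnD leq_pexp2l.
have hN : (#|nilhoms| <= q ^ (2 * homdim mu nu))%N.
  by rewrite -card_homs; apply: subset_leq_card; apply/fintype.subsetP => y; rewrite inE => /andP[].
apply: (@leq_trans (q * (2 * q ^ (2 * homdim mu nu)) * q ^ m)%N).
  rewrite leq_mul2r; apply/orP; right; apply: leq_mul; first exact: leq_subr.
  by apply: leq_trans hT2 _; rewrite leq_mul2l hN.
have -> : (q * (2 * q ^ (2 * homdim mu nu)) * q ^ m =
   2 * (q ^ (2 * homdim mu nu) * q ^ m.+1))%N by rewrite expnS; ring.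
rewrite -[leqRHS]mulnA; apply: leq_mul => //.
by lia.
Qed.

End OneType.

(** Coding partitions by short sequences of small numbers bounds their number
    independently of the field. *)
Definition through_code r (c : r.-bseq 'I_r.+1) : {set 'M[k]_n} :=
  if insub [seq val x | x <- c] is Some nu then @through r nu else finset.set0.

Lemma intpart_code r (nu : intpart r) :
  exists c : r.-bseq 'I_r.+1, [seq val x | x <- c] = nu.
Proof.
have hs : (size [seq inord x : 'I_r.+1 | x <- nu] <= r)%N.
  rewrite size_map -[leqRHS](sum_parts_n nu).
  elim: (parts nu) (part0 nu) => // x s IH.
  by rewrite inE negb_or big_cons /= => /andP[x0 /IH]; lia.
exists (Bseq hs); rewrite /= -map_comp -[RHS]map_id.
apply/eq_in_map => x hx /=; rewrite inordK // ltnS.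
exact: (allP (parts_le nu (leqnn r))).
Qed.

Lemma card_omega_le r m : (2 * r.+1 <= q - 1)%N -> ~ superdistinct mu ->
  n = (r + m)%N -> \rank (jordan_mx k lam) = r ->
  ((q - 1) * (#|omega k lam mu| * q ^ m) <=
     #|{: r.-bseq 'I_r.+1}| * (4 * n * q ^ homdim mu mu))%N.
Proof.
move=> hq nsd nrm rkJ.
have hB (c : r.-bseq 'I_r.+1) :
    ((q - 1) * q ^ m * #|through_code c| <= 4 * n * q ^ homdim mu mu)%N.
  rewrite /through_code; case: insubP => [nu _ _|_]; last by rewrite cards0 muln0.
  by rewrite -mulnA [(q ^ m * _)%N]mulnC; exact: card_through_le.
have hcov C : C \in omega k lam mu -> C \in (finset.set0 : {set 'M[k]_n}) \/
    exists c : r.-bseq 'I_r.+1, C \in through_code c.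
  move=> hC; right; have := hC; rewrite inE => /andP[hJ /existsP[P /andP[uP /eqP e]]].
  have rC : \rank C = r by rewrite e rank_conj.
  have [nu [pi [iota [h1 h2 h3 h4]]]] := jhom_factor hJ rC.
  have [c ec] := intpart_code nu; exists c.
  rewrite /through_code ec; case: insubP => [nu' _ /val_inj ->|]; last first.
    by case: (nu) => s hs /=; rewrite hs.
  by rewrite inE hC; apply/existsP; exists (pi, iota); rewrite /= h1 h2 h3 h4 eqxx.
have := card_cover hcov hB; rewrite cards0 muln0 add0n.
by rewrite -mulnA [(q ^ m * _)%N]mulnC.
Qed.

End UpperBound.

(** If the general element of jnil lam had type mu, then card_omega_ge would make
    omega larger, by a factor of the order of q, than card_omega_le allows. *)
Lemma no_generic_type n (lam mu : intpart n) : (0 < n)%N -> ~ superdistinct mu ->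
  exists Q0 : nat, forall k : finFieldType, (Q0 <= #|k|)%N ->
    (exists2 u1 : 'M[k]_n, u1 \in jnil lam &
      forall j, (\rank (jordan_mx k mu ^+ j) <= \rank (u1 ^+ j))%N) ->
    (forall u : 'M[k]_n, u \in jnil lam -> forall j,
      (\rank (u ^+ j) <= \rank (jordan_mx k mu ^+ j))%N) -> False.
Proof.
move=> n0 nsd; pose m := size lam; pose r := (n - m)%N.
have mn : (m <= n)%N.
  rewrite -[leqRHS](sum_parts_n lam) /m; elim: (parts lam) (part0 lam) => // x s IH.
  by rewrite inE negb_or big_cons /= => /andP[x0 /IH]; lia.
pose N := #|{: r.-bseq 'I_r.+1}|.
pose c := (2 * ((n + n * n) * (n * n).+1))%N.
exists (c + 2 * n.+1 + 16 * n * N + 2)%N => k hk [u1 hu1 u1ge] ule.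
have q0 : (0 < #|k|)%N by rewrite (cardD1 0) inE.
have rkJ : \rank (jordan_mx k lam) = r.
  rewrite -[jordan_mx k lam]expr1 rank_jordanX /r -[X in (X - _)%N](sum_parts_n lam) /m.
  elim: (parts lam) (part0 lam) => [|x s IH]; first by rewrite !big_nil.
  rewrite inE negb_or !big_cons => /andP[x0 hs].
  have hle : (size s <= \sum_(y <- s) y)%N.
    elim: s hs {IH} => // y s IH; rewrite inE negb_or big_cons /= => /andP[y0 /IH]; lia.
  by rewrite IH //=; lia.
have hg : (#|jnilset k lam| <= 2 * #|jgood k lam mu|)%N.
  by apply: (card_jgood hu1 u1ge ule) => //; rewrite -/c; lia.
have ha : (#|k| ^ homdim mu mu <= 2 * #|jaut k mu|)%N by apply: card_jaut; lia.
have ho := card_omega_ge k lam mu.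
have ht := card_jtri k lam.
have hu : ((#|k| - 1) * (#|omega k lam mu| * #|k| ^ m) <=
    N * (4 * n * #|k| ^ homdim mu mu))%N.
  by apply: card_omega_le => //; rewrite /r; lia.
have U0 : (0 < #|jnilset k lam|)%N by rewrite (cardD1 0) inE jnil0.
have Z0 : (0 < #|k| ^ homdim mu mu)%N by rewrite expn_gt0 q0.
set Z := (#|k| ^ homdim mu mu)%N in ha hu Z0.
set U := #|jnilset k lam| in hg ht U0.
set O := #|omega k lam mu| in ho hu.
have h1 : (Z * U <= 4 * (O * #|k| ^ m) * U)%N.
  apply: (leq_trans (leq_mul ha hg)).
  have -> : (2 * #|jaut k mu| * (2 * #|jgood k lam mu|) =
     4 * (#|jaut k mu| * #|jgood k lam mu|))%N by ring.
  rewrite -[leqRHS]mulnA leq_mul2l /=.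
  apply: (leq_trans ho); apply: (leq_trans (leq_mul ht (leqnn _))).
  by apply: eq_leq; rewrite -/O -/m; ring.
rewrite leq_pmul2r // in h1.
have h2 : ((#|k| - 1) * Z <= 16 * n * N * Z)%N.
  apply: (leq_trans (leq_mul (leqnn _) h1)).
  rewrite mulnCA; apply: (leq_trans (leq_mul (leqnn 4) hu)).
  by apply: eq_leq; ring.
by rewrite leq_pmul2r // in h2; lia.
Qed.

(** * Reduction to finite fields *)

Section Transfer.
Variable n : nat.

(** Functions of a matrix given by an integral formula, evaluated uniformly over
    all commutative rings. *)
Definition integral_fun (g : forall R : comNzRingType, 'M[R]_n -> R) :=
  forall (R S : comNzRingType) (phi : {rmorphism R -> S}) (W : 'M[R]_n),
    phi (g R W) = g S (map_mx phi W).

Definition monomx (R : comNzRingType) (d : 'I_n -> 'I_n -> nat) :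
  'M[{poly R}]_n := \matrix_(i, j) 'X^(d i j).

Lemma polyXn_nonroot (R : idomainType) (P : {poly {poly R}}) :
  P != 0 -> exists e, P.['X^e] != 0.
Proof.
move=> P0; pose rs := [seq 'X^e : {poly R} | e <- iota 0 (size P)].
have urs : uniq rs.
  rewrite map_inj_uniq ?iota_uniq // => a b /(congr1 (fun p : {poly R} => size p)).
  by rewrite !size_polyXn => -[].
have : ~~ all (root P) rs.
  apply/negP => h; have := max_poly_roots P0 h urs.
  by rewrite size_map size_iota ltnn.
by rewrite -has_predC => /hasP[_ /mapP[e _ ->]] /= h; exists e.
Qed.

(** A nonvanishing integral function has a nonvanishing monomial curve: the
    entries of W are replaced one at a time by powers of the variable. *)
Lemma integral_monomx (K : fieldType) g (W : 'M[K]_n) : integral_fun g ->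
  g K W != 0 -> exists d, g _ (monomx K d) != 0.
Proof.
move=> gn gW; pose R : idomainType := {poly K}.
pose M (s : seq ('I_n * 'I_n)) (d : 'I_n -> 'I_n -> nat) : 'M[R]_n :=
  \matrix_(i, j) if (i, j) \in s then 'X^(d i j) else (W i j)%:P.
suff main s : exists d, g R (M s d) != 0.
  have [d hd] := main (enum {: 'I_n * 'I_n}); exists d.
  rewrite (_ : monomx K d = M (enum {: 'I_n * 'I_n}) d) //.
  by apply/matrixP => i j; rewrite !mxE mem_enum.
elim: s => [|a s [d hd]].
  exists (fun _ _ => 0%N); suff -> : M [::] (fun _ _ => 0%N) = map_mx polyC W.
    by rewrite -(gn _ _ polyC) polyC_eq0.
  by apply/matrixP => i j; rewrite !mxE.
pose N : 'M[{poly R}]_n := \matrix_(i, j) if (i, j) == a then 'X else (M s d i j)%:P.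
have NE y : (g _ N).[y] = g R (\matrix_(i, j) if (i, j) == a then y else M s d i j).
  rewrite -[LHS]/(horner_eval y _) gn; congr (g R _); apply/matrixP => i j.
  rewrite [LHS]mxE [N i j]mxE [RHS]mxE.
  by case: ifP => _; [exact: hornerX | exact: hornerC].
have N0 : g _ N != 0.
  apply: contraNneq hd => e; have := NE (M s d a.1 a.2); rewrite e horner0 => h.
  rewrite [X in _ == X]h; apply/eqP; congr (g R _); apply/matrixP => i j; rewrite [RHS]mxE.
  by case: (eqVneq (i, j) a) => // <-.
have [e he] := polyXn_nonroot N0.
exists (fun i j => if (i, j) == a then e else d i j).
rewrite NE in he; suff <- : \matrix_(i, j) (if (i, j) == a then 'X^e else M s d i j) =
  M (a :: s) (fun i j => if (i, j) == a then e else d i j) by [].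
by apply/matrixP => i j; rewrite !mxE inE; case: (eqVneq (i, j) a).
Qed.

Lemma monomx_int (K : fieldType) g d : integral_fun g ->
  g _ (monomx K d) = map_poly intr (g _ (monomx int d)).
Proof.
move=> gn; rewrite -[RHS]/((map_poly (intmul 1) : {rmorphism {poly int} -> {poly K}}) _) gn.
by congr (g _ _); apply/matrixP => i j; rewrite !mxE /= map_polyXn.
Qed.

Lemma monomx_horner (K : fieldType) g d x : integral_fun g ->
  (g _ (monomx K d)).[x] = g K (\matrix_(i, j) x ^+ d i j).
Proof.
move=> gn; rewrite -[LHS]/(horner_eval x _) gn; congr (g K _).
by apply/matrixP => i j; rewrite !mxE; exact: hornerXn.
Qed.

End Transfer.

Lemma intr_eq0_pchar (k : fieldType) p (c : int) : p \in [pchar k] ->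
  (c%:~R == 0 :> k) = (p %| `|c|)%N.
Proof.
move=> hp; rewrite (dvdn_pcharf hp); case: c => m; first by rewrite -pmulrn absz_nat.
by rewrite NegzE mulrNz oppr_eq0 -pmulrn abszN absz_nat.
Qed.

Lemma intr_eq0_char0 (F : fieldType) (c : int) : ~ (exists p, p \in [pchar F]) ->
  c%:~R = 0 :> F -> c = 0.
Proof.
move=> h0 hc; apply/eqP; rewrite -absz_eq0; apply/negPn/negP; rewrite -lt0n => hpos.
apply: h0; suff e : `|c|%:R == 0 :> F by have [p hp] := natf0_pchar hpos e; exists p.
move/eqP: hc; case: c {hpos} => m; first by rewrite -pmulrn absz_nat.
by rewrite NegzE mulrNz abszN absz_nat -pmulrn oppr_eq0.
Qed.

(** A prime modulo which c0 survives, and which respects the integers that vanish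
    in F: the characteristic of F, or a large prime in characteristic 0. *)
Lemma reduction_prime (F : fieldType) (c0 : int) : c0%:~R != 0 :> F ->
  exists2 p, prime p & forall k : fieldType, p \in [pchar k] ->
    c0%:~R != 0 :> k /\ (forall c : int, c%:~R = 0 :> F -> c%:~R = 0 :> k).
Proof.
move=> hc0; have [[p hp]|h0] := boolp.pselect (exists p, p \in [pchar F]).
  exists p; first exact: pcharf_prime hp.
  move=> k hk; split; first by rewrite (intr_eq0_pchar _ hk) -(intr_eq0_pchar _ hp).
  by move=> c /eqP hc; apply/eqP; rewrite (intr_eq0_pchar _ hk) -(intr_eq0_pchar _ hp).
have [p lt pr] := prime_above `|c0|; exists p => // k hk; split.
  rewrite (intr_eq0_pchar _ hk); apply/negP => /dvdn_leq h.
  have /h : (0 < `|c0|)%N by rewrite lt0n absz_eq0; apply: contraNneq hc0 => ->.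
  by rewrite leqNgt lt.
by move=> c /(intr_eq0_char0 h0) ->.
Qed.

Lemma finite_nonroot (k : finFieldType) (P : {poly k}) :
  P != 0 -> (size P <= #|k|)%N -> exists x, P.[x] != 0.
Proof.
move=> P0 hs; have : ~~ all (root P) (enum k).
  apply/negP => h; have := max_poly_roots P0 h (enum_uniq _).
  by rewrite -cardE ltnNge hs.
by rewrite -has_predC => /hasP[x _ /= hx]; exists x.
Qed.

Section Reduction.
Variables (F : fieldType) (n : nat) (lam mu : intpart n).
Hypothesis F_infinite : infinite_field F.

Lemma integral_minor r j (f g : 'I_r -> 'I_n) :
  integral_fun (fun (R : comNzRingType) (W : 'M[R]_n) => minorX j f g (genm lam W)).
Proof. by move=> R S phi W; rewrite map_minorX map_genm. Qed.

(** The product of one nonvanishing minor for each power. *)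
Lemma integral_ranks (u : 'M[F]_n) N : u \in jnil lam ->
  exists g : forall R : comNzRingType, 'M[R]_n -> R, [/\ integral_fun g, g F u != 0 &
    forall (K : fieldType) (W : 'M[K]_n), g K W != 0 -> forall j, (j < N)%N ->
      (\rank (u ^+ j) <= \rank ((genm lam W) ^+ j))%N].
Proof.
move=> hu; elim: N => [|N [g [gn gu gr]]].
  by exists (fun _ _ => 1); split; rewrite ?oner_neq0 // => R S phi W; rewrite rmorph1.
have [f1 [f2 h]] := rank_minorX N u.
exists (fun R W => g R W * minorX N f1 f2 (genm lam W)); split.
- by move=> R S phi W; rewrite rmorphM gn (integral_minor N f1 f2).
- by rewrite genm_id // mulf_neq0.
move=> K W; rewrite mulf_eq0 negb_or => /andP[/gr h1 /minorX_rank h2] j.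
by rewrite ltnS leq_eqVlt => /predU1P[-> //|]; exact: h1.
Qed.

(** The rank conditions concern minors of genm lam W, which are integral functions
    of W. A minor that does not vanish at some W does not vanish on some monomial
    curve, where it is a polynomial with integer coefficients; this polynomial
    can be moved from F to the finite field and back. *)
Lemma generic_type_finite Q0 :
  (exists2 u : 'M[F]_n, u \in jnil lam & jordan_orbit mu u) ->
  (forall u : 'M[F]_n, u \in jnil lam -> forall j,
      (\rank (u ^+ j) <= \rank (jordan_mx F mu ^+ j))%N) ->
  exists k : finFieldType, [/\ (Q0 <= #|k|)%N,
    exists2 u1 : 'M[k]_n, u1 \in jnil lam &
      forall j, (\rank (jordan_mx k mu ^+ j) <= \rank (u1 ^+ j))%N &
    forall u : 'M[k]_n, u \in jnil lam -> forall j,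
      (\rank (u ^+ j) <= \rank (jordan_mx k mu ^+ j))%N].
Proof.
move=> [u hu hmu] ule.
have [g [gn gu gr]] := integral_ranks n hu.
have [d] := integral_monomx gn gu; rewrite monomx_int //.
set G := g _ (monomx int d) => G0.
have [i hi] : exists i, (G`_i)%:~R != 0 :> F.
  apply: boolp.contrapT => h; case/eqP: G0; apply/polyP => i; rewrite coef_map coef0 /=.
  by apply/eqP/negPn/negP => hi; apply: h; exists i.
have [p pr hp] := reduction_prime hi.
have [k pk ck] := pPrimePowerField pr (ltn0Sn (Q0 + size G)).
have hk : (Q0 + size G <= #|k|)%N.
  by rewrite ck; apply: ltnW; apply: leq_trans (ltn_expl _ (prime_gt1 pr)) _;
    rewrite leq_exp2l ?prime_gt1.
have [h1 h2] := hp k pk.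
exists k; split.
- exact: leq_trans (leq_addr _ _) hk.
- pose Gk : {poly k} := map_poly intr G.
  have Gk0 : Gk != 0.
    by apply: contraNneq h1 => e; rewrite -coef_map /= -/Gk e coef0.
  have [|x hx] := finite_nonroot Gk0.
    by apply: leq_trans (size_poly _ _) _; exact: leq_trans (leq_addl _ _) hk.
  rewrite /Gk -monomx_int // monomx_horner // in hx.
  exists (genm lam (\matrix_(i, j) x ^+ d i j)); first exact: genm_jnil.
  move=> j; case: (ltnP j n) => hj.
    by apply: leq_trans (gr _ _ hx j hj); rewrite (rank_orbit j hmu) !rank_jordanX.
  by rewrite -(subnKC hj) exprD jordan_nilp mul0r mxrank0.
move=> v hv j; rewrite leqNgt; apply/negP => lt.
have [f1 [f2 h]] := rank_minorX j v.
have [g' gn' gE] : exists2 g' : forall R : comNzRingType, 'M[R]_n -> R, integral_fun g' &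
    forall (K : fieldType) (W : 'M[K]_n), g' K W = minorX j f1 f2 (genm lam W).
  by exists (fun R W => minorX j f1 f2 (genm lam W)) => //; exact: integral_minor.
have hv' : g' k v != 0 by rewrite gE genm_id.
have [d' hd'] := integral_monomx gn' hv'; rewrite monomx_int // in hd'.
have : map_poly intr (g' _ (monomx int d')) != 0 :> {poly F}.
  apply: contraNneq hd' => e; apply/eqP/polyP => i'; rewrite coef_map coef0 /=.
  by apply: h2; have := congr1 (fun q : {poly F} => q`_i') e; rewrite coef_map coef0.
rewrite -monomx_int // => /F_infinite [x]; rewrite monomx_horner // gE => /minorX_rank.
rewrite leqNgt => /negP; apply; apply: leq_ltn_trans (ule _ (genm_jnil _ _) j) _.
by move: lt; rewrite !rank_jordanX.
Qed.

End Reduction.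

(** * Generic types have gaps *)

Section Conclusion.
Variables (F : closedFieldType) (n : nat).

(** The default value of xget is avoided by generic_exists. *)
Lemma generic_intpartP (lam : intpart n) : generic_for F lam (generic_intpart F lam).
Proof.
have [mu hmu] := generic_exists (@closed_infinite F) lam.
rewrite /generic_intpart; case: xgetP => [nu _ //|/(_ mu)].
by case.
Qed.

Lemma generic_type_superdistinct (lam mu : intpart n) : (0 < n)%N ->
  generic_for F lam mu -> superdistinct mu.
Proof.
move=> n0 gen; apply: boolp.contrapT => nsd.
have [Q0 hQ] := no_generic_type lam n0 nsd.
have [ex le] := generic_jnil gen.
have [k [hk ex' le']] := generic_type_finite (@closed_infinite F) Q0 ex le.
exact: hQ hk ex' le'.
Qed.

End Conclusion.

Theorem theorem3p2 (F : closedFieldType) (n : nat) (n_ge1 : (1 <= n)%N) :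
  (forall (B : 'M[F]_n) (lam : intpart n),
     nilpotent_mx B -> jordan_orbit lam B ->
     let mu := generic_intpart F lam in
     zariski_dense_in (jordan_orbit mu `&` nilcomm B)%classic (nilcomm B) /\
     (forall i : nat, (i.+1 < size mu)%N ->
        (2 <= nth 0 mu i - nth 0 mu i.+1)%N)) /\
  idempotent_fun (@generic_intpart F n).
Proof.
have sd (lam : intpart n) : superdistinct (generic_intpart F lam).
  exact: generic_type_superdistinct n_ge1 (@generic_intpartP F n lam).
split=> [B lam _ hB mu|lam /=]; last first.
  exact: generic_superdistinct (sd lam) (@generic_intpartP F n _).
by split; [exact: (@generic_intpartP F n lam B hB) | exact: sd].
Qed.
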